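(* Let $d\ge 1$, let $r\ge 0$ be an integer and let $f\in H^r_p([-\pi,\pi]^d)$. For $N\ge 1$ let $f_N^c=\mathcal P_N^c f$ be the conservative projection of $f$ on the space $\mathbb P^N$ of trigonometric polynomials of degree $N$, i.e. the best $L^2_p$-approximation of $f$ in $\mathbb P^N$ subject to the constraint $\langle f_N^c,\Phi\rangle=\langle f,\Phi\rangle$, where $\Phi(v)=(1,v_1,\dots,v_d,|v|^2)^T$. Then $$\|f-f_N^c\|_{L^2_p}\le \frac{C_\Phi}{N^r}\,\|f\|_{H^r_p},$$ where the constant $C_\Phi$ (independent of $f$ and $N$) depends on the spectral radius of the matrix $\langle\Phi,\Phi^T\rangle$ and on $\|\Phi\|_{2,L^2_p}^2=\sum_{j=1}^{d+2}\|\Phi_j\|_{L^2_p}^2$, where $\Phi_j$, $j=1,\dots,d+2$, are the components of $\Phi$.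
   Context: $L^2_p([-\pi,\pi]^d)$ is the space of (real-valued) square-integrable functions on $[-\pi,\pi]^d$, extended periodically, with inner product $\langle f,g\rangle=\int_{[-\pi,\pi]^d} f g\,dv$ (complex conjugate on the second factor if complex-valued functions are used) and norm $\|f\|_{L^2_p}^2=\langle f,f\rangle$. $H^r_p([-\pi,\pi]^d)$ is the subspace of the Sobolev space $H^r([-\pi,\pi]^d)$ consisting of periodic functions. $\mathbb P^N=\mathrm{span}\{e^{ik\cdot v}\,:\,k\in\mathbb Z^d,\ -N\le k_j\le N,\ j=1,\dots,d\}$. $\Phi(v)=(1,v_1,\dots,v_d,|v|^2)^T\in\mathbb R^{d+2}$ for $v\in[-\pi,\pi]^d$; $\langle f,\Phi\rangle\in\mathbb R^{d+2}$ is the vector $\int_{[-\pi,\pi]^d} f\,\Phi\,dv$ taken componentwise; $\langle\Phi,\Phi^T\rangle$ is the $(d+2)\times(d+2)$ matrix with entries $\int_{[-\pi,\pi]^d}\Phi_i\Phi_j\,dv$. The conservative projection is $$f_N^c=\mathcal P_N^c f=\operatorname{argmin}\left\{\|g_N-f\|_{L^2_p}^2\,:\,g_N\in\mathbb P^N,\ \langle g_N,\Phi\rangle=\langle f,\Phi\rangle\right\}.$$ The constant $C_\Phi$ may also depend on the fixed parameters $d$ and $r$. *)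

(* Defs.v *)
From HB Require Import structures.
From mathcomp Require Import all_boot all_order all_algebra.
From mathcomp Require Import all_classical all_reals all_analysis.
From mathcomp Require Import complex.

Set Implicit Arguments.
Unset Strict Implicit.
Unset Printing Implicit Defensive.

Import Order.TTheory GRing.Theory Num.Theory.
Import numFieldNormedType.Exports.

Local Open Scope classical_set_scope.
Local Open Scope ring_scope.
Local Open Scope complex_scope.

(* The d-dimensional Lebesgue measure is the d-fold product of the
   one-dimensional one.  It lives on d-tuples, which carry the product
   (= Borel) sigma-algebra in the library. *)
Section cons_measure.
Context (R : realType) (n : nat).
Let T := measurableTypeR R.
Variable m : {sigma_finite_measure set (n.-tuple T) -> \bar R}.

Definition cons_pair (p : T * n.-tuple T) : n.+1.-tuple T :=
  [tuple of p.1 :: p.2].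

Lemma measurable_cons_pair : measurable_fun [set: T * n.-tuple T] cons_pair.
Proof. by apply: measurable_cons. Qed.

Definition cons_measure : set (n.+1.-tuple T) -> \bar R :=
  pushforward (@lebesgue_measure R \x m)%E cons_pair.

Let cons_measure0 : cons_measure set0 = 0%E.
Proof. by rewrite /cons_measure /pushforward preimage_set0 measure0. Qed.

Let cons_measure_ge0 A : (0 <= cons_measure A)%E.
Proof. by rewrite /cons_measure /pushforward measure_ge0. Qed.

Let measurable_preimage A :
  measurable A -> measurable (cons_pair @^-1` A).
Proof.
by move=> mA; rewrite -[X in measurable X]setTI; exact: measurable_cons_pair.
Qed.

Let cons_measure_sigma_additive : semi_sigma_additive cons_measure.
Proof.
move=> F mF tF mUF; rewrite /cons_measure /pushforward preimage_bigcup.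
apply: measure_semi_sigma_additive.
- by move=> n'; exact: measurable_preimage.
- apply/trivIsetP => /= i j _ _ ij; rewrite -preimage_setI.
  by move/trivIsetP : tF => /(_ _ _ _ _ ij) ->//; rewrite preimage_set0.
- by rewrite -preimage_bigcup; exact: measurable_preimage.
Qed.

HB.instance Definition _ := isMeasure.Build _ _ _ cons_measure
  cons_measure0 cons_measure_ge0 cons_measure_sigma_additive.

Let uncons (t : n.+1.-tuple T) : T * n.-tuple T :=
  (tnth t ord0, [tuple of behead t]).

Let measurable_uncons : measurable_fun setT uncons.
Proof.
apply/measurable_fun_pairP; split; first exact: measurable_tnth.
exact: measurable_behead.
Qed.

Let cons_pairK : cancel cons_pair uncons.
Proof. by move=> [x t]; congr pair => //=; apply/val_inj. Qed.

Let cons_measure_sigma_finite : sigma_finite setT cons_measure.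
Proof.
have /sigma_finiteP[F [FT ndF Foo]] :=
  sigma_finiteT (lebesgue_measure : {sigma_finite_measure set T -> \bar R}).
have /sigma_finiteP[G [GT ndG Goo]] := sigma_finiteT m.
exists (fun k => uncons @^-1` (F k `*` G k)).
  apply/esym; rewrite -subTset => t _.
  have : [set: T] (uncons t).1 by [].
  have : [set: n.-tuple T] (uncons t).2 by [].
  rewrite FT GT => -[j _ Gj] [i _ Fi]; exists (maxn i j) => //; split.
    by move: Fi; exact/subsetPset/ndF/leq_maxl.
  by move: Gj; exact/subsetPset/ndG/leq_maxr.
move=> k; have [mF Fk] := Foo k; have [mG Gk] := Goo k; split.
  rewrite -[X in measurable X]setTI; apply: measurable_uncons => //.
  exact: measurableX.
rewrite /cons_measure /pushforward -comp_preimage.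
rewrite (_ : uncons \o _ = id); last by apply/funext => p; exact: cons_pairK.
by rewrite preimage_id product_measure1E// lte_mul_pinfty// ge0_fin_numE.
Qed.

HB.instance Definition _ := Measure_isSigmaFinite.Build _ _ _ cons_measure
  cons_measure_sigma_finite.

End cons_measure.

Fixpoint lebesgue_tuple (R : realType) (d : nat) :
    {sigma_finite_measure set (d.-tuple (measurableTypeR R)) -> \bar R} :=
  match d with
  | 0 => @dirac _ (0.-tuple (measurableTypeR R)) [tuple] R
  | d'.+1 => cons_measure (lebesgue_tuple R d')
  end.

Section periodic_spaces.
Context (R : realType) (d : nat).
Implicit Types (f g : 'rV[R]_d -> R) (a : 'I_d -> nat) (s : seq 'I_d).

Definition row_of (t : d.-tuple (measurableTypeR R)) : 'rV[R]_d :=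
  \row_i tnth t i.

Definition box : set (d.-tuple (measurableTypeR R)) :=
  [set t | forall i, - pi <= tnth t i <= pi].

(* The integral of f over [-pi, pi]^d. *)
Definition box_integral f : R :=
  (\int[lebesgue_tuple R d]_(t in box) f (row_of t))%R.

Definition inner f g : R := box_integral (fun v => f v * g v).

Definition L2norm f : R := Num.sqrt (inner f f).

Definition coord_vec (i : 'I_d) : 'rV[R]_d := delta_mx 0 i.

Definition box_periodic f : Prop :=
  forall i, periodic f ((2 * pi) *: coord_vec i).

Definition L2p : set ('rV[R]_d -> R) :=
  [set f | [/\ box_periodic f,
     measurable_fun [set: d.-tuple (measurableTypeR R)] (f \o row_of) &
     (lebesgue_tuple R d).-integrable box
       (fun t => ((f (row_of t)) ^+ 2)%:E)]].

Definition partials s f : 'rV[R]_d -> R :=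
  foldr (fun i g => 'D_(coord_vec i) g) f s.

Definition smooth f : Prop :=
  forall s, continuous (partials s f) /\
    forall i v, derivable (partials s f) v (coord_vec i).

Definition multi_partial a f : 'rV[R]_d -> R :=
  partials (flatten [seq nseq (a i) i | i <- enum 'I_d]) f.

Definition multi_order a : nat := (\sum_i a i)%N.

(* g is the derivative of f of multi-index a in the sense of periodic
   distributions: the test functions are the smooth periodic functions and
   there are no boundary terms.  Testing only against functions with compact
   support in the open box would allow the periodic extension of f, or of its
   derivatives, to jump across the faces of the box. *)
Definition weak_derivative a f g : Prop :=
  forall phi, smooth phi -> box_periodic phi ->
    inner f (multi_partial a phi) = (-1) ^+ multi_order a * inner g phi.

Definition Hp (r : nat) : set ('rV[R]_d -> R) :=
  [set f | L2p f /\
     forall a, (multi_order a <= r)%N ->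
       exists2 g, L2p g & weak_derivative a f g].

(* A representative of the weak derivative, which is unique almost
   everywhere; the value outside Hp is irrelevant. *)
Definition weak_partial a f : 'rV[R]_d -> R :=
  xget (fun=> 0) [set g | L2p g /\ weak_derivative a f g].

Definition Hnorm (r : nat) f : R :=
  Num.sqrt (\sum_(a : {ffun 'I_d -> 'I_r.+1} |
                     (multi_order (fun i => a i) <= r)%N)
    L2norm (weak_partial (fun i => a i) f) ^+ 2).

End periodic_spaces.

Section conservative_projection.
Context (R : realType) (d : nat).
Implicit Types (f g h : 'rV[R]_d -> R).

Definition expi (x : R) : R[i] := cos x +i* sin x.

(* The index k : 'I_d -> 'I_(2N+1) encodes the frequency with components
   k_j - N, which range over -N, ..., N. *)
Definition phase (N : nat) (k : {ffun 'I_d -> 'I_N.*2.+1}) (v : 'rV[R]_d) : R :=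
  \sum_j ((k j)%:R - N%:R) * v 0 j.

(* The real-valued elements of the complex span of the exponentials. *)
Definition trig_poly (N : nat) : set ('rV[R]_d -> R) :=
  [set g | exists c : {ffun 'I_d -> 'I_N.*2.+1} -> R[i],
     forall v, (g v)%:C = \sum_k c k * expi (phase k v)].

Definition Phi (v : 'rV[R]_d) : 'cV[R]_(1 + (d + 1)) :=
  col_mx (const_mx 1) (col_mx v^T (const_mx (\sum_j v 0 j ^+ 2))).

Definition Phi_comp (j : 'I_(1 + (d + 1))) : 'rV[R]_d -> R :=
  fun v => Phi v j 0.

Definition moments f : 'cV[R]_(1 + (d + 1)) := \col_j inner f (Phi_comp j).

Definition Phi_gram : 'M[R]_(1 + (d + 1)) :=
  \matrix_(i, j) inner (Phi_comp i) (Phi_comp j).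

Definition Phi_norm2 : R := \sum_j L2norm (Phi_comp j) ^+ 2.

Definition admissible (N : nat) f : set ('rV[R]_d -> R) :=
  [set g | trig_poly N g /\ moments g = moments f].

Definition conservative_projection (N : nat) f : set ('rV[R]_d -> R) :=
  [set g | admissible N f g /\
     forall h, admissible N f h -> L2norm (g \- f) ^+ 2 <= L2norm (h \- f) ^+ 2].

End conservative_projection.

Arguments Phi_gram : clear implicits.
Arguments Phi_norm2 : clear implicits.

(* Largest modulus of a complex eigenvalue. *)
Definition spectral_radius (R : realType) (n : nat) (A : 'M[R]_n) : R :=
  sup [set ComplexField.Normc.normc z |
        z in [set z : R[i] | eigenvalue (map_mx (real_complex R) A) z]].

(* Main.v *)
Require Import Defs.
From mathcomp Require Import all_boot all_order all_algebra.
From mathcomp Require Import all_classical all_reals all_analysis.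
From mathcomp Require Import measurable_realfun complex ring lra zify.

(** The conservative projection is a best approximation under linear
    constraints, so its error is at most that of any admissible competitor.  The
    competitor is the Fourier sum [P f] of degree [N], corrected so that it has
    the moments of [f].  Already at degree one there are trigonometric
    polynomials [psi m] dual to the components of [Phi] ([dual_functions]):
    multiples of [sin v_i] see only the moment of [v_i], and [cos v_i] sees only
    that of [|v|^2].  Adding the combination of the [psi m] whose coefficients are
    the moments of [f - P f] costs, by Cauchy-Schwarz, a constant times
    [|f - P f|], and the constant does not involve [N] ([quasi_optimal]).

    It remains to bound [|f - P f|].  A weak derivative of order [r] in the
    direction [j] multiplies the energy of [f] at the frequency [k] by
    [k_j ^ (2 r)] ([weak_derivative_energy]).  A frequency outside the cube of
    size [N] has a component larger than [N], so the energy of [f] beyond the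
    cube is at most [N ^ (- 2 r)] times the energies of the derivatives, which
    Bessel's inequality bounds by their norms ([fourier_rate]).

    That [f] has no energy other than that of its frequencies is the density of
    trigonometric polynomials in the square-integrable functions on the box
    ([trig_poly_dense]).  Trigonometric polynomials form an algebra, and a suitable
    polynomial in [cos (v_i - m)] is close to the indicator of an arc, so the
    sets whose indicators are limits of trigonometric polynomials form a
    sigma-algebra that contains the half-spaces [v_i < a]; it contains all
    measurable sets, and simple functions give the rest.

    The minimum is attained because the competitors form an affine space of
    finite dimension, onto which there is an orthogonal projection
    ([span_projection], [conservative_projection_exists]). *)

Set Implicit Arguments.
Unset Strict Implicit.
Unset Printing Implicit Defensive.

Import Order.TTheory GRing.Theory Num.Theory.
Import numFieldNormedType.Exports.

Local Open Scope classical_set_scope.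
Local Open Scope ring_scope.

(** * Integration over the box *)

Section measure.
Context (R : realType).
Implicit Types d : nat.

Lemma preimage_cons_box d :
  @cons_pair R d @^-1` (@box R d.+1) = `[- pi, pi]%classic `*` (@box R d).
Proof.
apply/seteqP; split => [[x t]|[x t]] /=.
  move=> h; split; first by have := h ord0; rewrite tnth0 /= in_itv.
  by move=> i; have := h (lift ord0 i); rewrite tnthS.
move=> [+ h] i; rewrite /= in_itv /= => hx.
by case: (unliftP ord0 i) => [j|] -> ; rewrite ?tnth0 ?tnthS //.
Qed.

Lemma measurable_box d : measurable (@box R d).
Proof.
rewrite (_ : @box R d = \bigcap_(i in [set: 'I_d])
  ((fun t : d.-tuple _ => tnth t i) @^-1` `[- pi, pi]%classic)).
  apply: fin_bigcap_measurable => // i _.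
  by rewrite -[X in measurable X]setTI; apply: measurable_tnth.
by apply/seteqP; split => t /= h i; move: (h i); rewrite /= in_itv /= => // /(_ I).
Qed.

Lemma lebesgue_itv_pi : lebesgue_measure (`[- pi, pi]%classic : set R) = (2 * pi)%:E.
Proof.
rewrite lebesgue_measure_itv /= lte_fin gtrN ?pi_gt0 //= -EFinB opprK.
by congr EFin; ring.
Qed.

Lemma lebesgue_tuple_box d : lebesgue_tuple R d (@box R d) = ((2 * pi) ^+ d)%:E.
Proof.
elim: d => [|d IH].
  by rewrite expr0 /= diracE mem_set // => -[].
rewrite [LHS]/= /cons_measure /pushforward preimage_cons_box product_measure1E //;
  last exact: measurable_box.
by move: lebesgue_itv_pi IH => /= -> ->; rewrite -EFinM exprS.
Qed.

Lemma box_lty d : (lebesgue_tuple R d (@box R d) < +oo)%E.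
Proof. by rewrite lebesgue_tuple_box ltry. Qed.

Lemma bounded_integrable_box d (F : d.-tuple (measurableTypeR R) -> R) (M : R) :
  measurable_fun setT F -> (forall t, box t -> `|F t| <= M) ->
  (lebesgue_tuple R d).-integrable (@box R d) (EFin \o F).
Proof.
move=> mF FM; apply: measurable_bounded_integrable.
- exact: measurable_box.
- exact: box_lty.
- exact: measurable_funTS.
- exists M; split; first exact: num_real.
  by move=> x Mx t bt; apply: le_trans (FM t bt) (ltW Mx).
Qed.

Lemma bounded_integrable_itv (f : R -> R) (M : R) : measurable_fun setT f ->
  (forall x, - pi <= x <= pi -> `|f x| <= M) ->
  lebesgue_measure.-integrable (`[- pi, pi]%classic : set R) (EFin \o f).
Proof.
move=> mf fM; apply: measurable_bounded_integrable.
- exact: measurable_itv.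
- by move: lebesgue_itv_pi => /= ->; rewrite ltry.
- exact: measurable_funTS.
- exists M; split; first exact: num_real.
  move=> y My x /=; rewrite in_itv /= => xI.
  exact: le_trans (fM _ xI) (ltW My).
Qed.

(** Fubini's theorem in the form that allows induction on the dimension. *)
Lemma integral_box_cons d (F : d.+1.-tuple (measurableTypeR R) -> R) (M : R) :
  measurable_fun setT F -> (forall t, box t -> `|F t| <= M) ->
  \int[lebesgue_tuple R d.+1]_(t in @box R d.+1) F t =
  \int[lebesgue_measure]_(x in `[- pi, pi])
    (\int[lebesgue_tuple R d]_(t in @box R d) F (cons_pair (x, t))).
Proof.
move=> mF FM.
have mB := @measurable_box d.+1.
pose G : d.+1.-tuple (measurableTypeR R) -> \bar R := (EFin \o F) \_ (@box R d.+1).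
have mG : measurable_fun [set: d.+1.-tuple (measurableTypeR R)] G.
  apply/(measurable_restrictT _ mB).
  by apply/measurable_EFinP; apply: measurable_funTS.
have iG : (lebesgue_tuple R d.+1).-integrable setT G.
  apply/(integrable_mkcond _ mB).
  exact: bounded_integrable_box mF FM.
rewrite /Rintegral integral_mkcond -/G.
have mc := @measurable_cons_pair R d.
have iGc : (lebesgue_measure \x lebesgue_tuple R d)%E.-integrable setT
  (G \o @cons_pair R d).
  apply/integrableP; split; first exact: measurableT_comp.
  have /integrableP[_] := iG.
  rewrite [X in (X < _)%E -> _](_ : _ = \int[pushforward
    (lebesgue_measure \x lebesgue_tuple R d)%E (@cons_pair R d)]_x `|G x|)%E //.
  rewrite ge0_integral_pushforward //.
  exact: measurableT_comp.
rewrite [X in fine X](_ : _ = \int[pushforward (lebesgue_measure \x lebesgue_tuple R d)%E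
  (@cons_pair R d)]_x G x)%E //.
rewrite integral_pushforward //.
rewrite preimage_setT -(integral12_prod_meas1 iGc).
congr fine; rewrite [RHS]integral_mkcond; apply: eq_integral => x _.
rewrite patchE /fubini_F; case: ifPn => [|xI]; last first.
  apply: integral0_eq => t _ /=; rewrite /G patchE memNset // => h.
  have : (@cons_pair R d @^-1` (@box R d.+1)) (x, t) by [].
  rewrite preimage_cons_box => -[/= h1 _].
  by move: xI; rewrite mem_set.
rewrite inE => xI.
rewrite fineK.
  rewrite [RHS]integral_mkcond; apply: eq_integral => t _.
  rewrite /= /G !patchE; congr (if _ then _ else _).
  have := congr1 (fun A => A (x, t)) (preimage_cons_box d) => /= E.
  apply/idP/idP; rewrite !inE E // => -[] //.
have mFx : measurable_fun setT (fun t => F (cons_pair (x, t))).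
  apply: (measurableT_comp mF).
  by apply: (measurableT_comp mc); apply: measurable_fun_pair.
apply: integrable_fin_num; first exact: measurable_box.
apply: (bounded_integrable_box (M := M) mFx) => t bt.
apply: FM; have := congr1 (fun A => A (x, t)) (preimage_cons_box d) => /= ->.
by split.
Qed.

End measure.

(** * One-dimensional integrals *)

Section onedim.
Context (R : realType).

(** The fundamental theorem of calculus on the period, for antiderivatives given
    on the whole line. *)
Lemma integral_derive (F f : R -> R) : (forall x : R, is_derive x (1 : R) F (f x)) ->
  continuous f ->
  \int[lebesgue_measure]_(x in `[- pi, pi]) f x = F pi - F (- pi).
Proof.
move=> dF cf; rewrite /Rintegral (@continuous_FTC2 _ f F) //.
- by rewrite gtrN // pi_gt0.
- exact: continuous_subspaceT.
- have cF : continuous F.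
    by move=> x; apply/differentiable_continuous/derivable1_diffP; have [] := dF x.
  split.
  + by move=> x _; have [] := dF x.
  + by apply: cvg_at_right_filter; exact: cF.
  + by apply: cvg_at_left_filter; exact: cF.
- by move=> x _; rewrite derive1E; have [] := dF x.
Qed.

Lemma integral_cos_freq (k c : R) : k != 0 -> sin (k * pi) = 0 ->
  \int[lebesgue_measure]_(x in `[- pi, pi]) cos (k * x + c) = 0.
Proof.
move=> k0 sk.
pose F : R -> R := k^-1 \*: (sin \o (k \*: id + cst c)).
have dF (x : R) : is_derive x (1 : R) F (cos (k * x + c)).
  apply: is_derive_eq.
  rewrite /GRing.scale /= !fctE /cst /= addr0 /GRing.scale /=; field; exact: k0.
rewrite (integral_derive dF).
- have FE y : F y = k^-1 * sin (k * y + c) by [].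
  rewrite !FE mulrN !sinD !cosN sinN sk; ring.
- move=> x; apply: (continuous_comp (f := fun x => k * x + c) (g := cos));
  last exact: continuous_cos.
  apply: cvgD; [apply: cvgMr; exact: cvg_id|exact: cvg_cst].
Qed.

Lemma integral_id : \int[lebesgue_measure]_(x in `[- pi, pi]) (x : R) = 0.
Proof.
pose F : R -> R := (2^-1 \*: (id ^+ 2)).
have dF (x : R) : is_derive x (1 : R) F (id x).
  apply: is_derive_eq.
  by rewrite /GRing.scale /= /GRing.scale /=; field.
rewrite (integral_derive dF).
- have FE y : F y = 2^-1 * y ^+ 2 by [].
  by rewrite !FE sqrrN subrr.
- by move=> x; apply: cvg_id.
Qed.

Lemma integral_x_sin : \int[lebesgue_measure]_(x in `[- pi, pi]) (sin x * x : R) = 2 * pi.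
Proof.
pose F : R -> R := (sin - id * cos).
have dF (x : R) : is_derive x (1 : R) F (sin x * x).
  apply: is_derive_eq.
  rewrite /GRing.scale /=; ring.
rewrite (integral_derive dF).
- have FE y : F y = sin y - y * cos y by [].
  rewrite !FE !cosN !sinN sinpi cospi; ring.
- move=> x; apply: cvgM; [exact: continuous_sin| exact: cvg_id].
Qed.

Lemma integral_x_cos : \int[lebesgue_measure]_(x in `[- pi, pi]) (cos x * x : R) = 0.
Proof.
pose F : R -> R := (cos + id * sin).
have dF (x : R) : is_derive x (1 : R) F (cos x * x).
  apply: is_derive_eq.
  rewrite /GRing.scale /=; ring.
rewrite (integral_derive dF).
- have FE y : F y = cos y + y * sin y by [].
  rewrite !FE !cosN !sinN sinpi cospi; ring.
- move=> x; apply: cvgM; [exact: continuous_cos| exact: cvg_id].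
Qed.

Lemma integral_x2_sin : \int[lebesgue_measure]_(x in `[- pi, pi]) (sin x * x ^+ 2 : R) = 0.
Proof.
pose F : R -> R := (2 \*: cos + 2 \*: (id * sin) - id ^+ 2 * cos).
have dF (x : R) : is_derive x (1 : R) F (sin x * x ^+ 2).
  apply: is_derive_eq.
  rewrite /GRing.scale /= /GRing.scale /= !fctE; ring.
rewrite (integral_derive dF).
- have FE y : F y = 2 * cos y + 2 * (y * sin y) - y ^+ 2 * cos y by [].
  rewrite !FE !cosN !sinN sinpi cospi; ring.
- move=> x; apply: cvgM; [exact: continuous_sin| exact: exprn_continuous].
Qed.

Lemma integral_x2_cos : \int[lebesgue_measure]_(x in `[- pi, pi]) (cos x * x ^+ 2 : R) =
  - (4 * pi).
Proof.
pose F : R -> R := (id ^+ 2 * sin + 2 \*: (id * cos) - 2 \*: sin).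
have dF (x : R) : is_derive x (1 : R) F (cos x * x ^+ 2).
  apply: is_derive_eq.
  rewrite /GRing.scale /= /GRing.scale /= !fctE; ring.
rewrite (integral_derive dF).
- have FE y : F y = y ^+ 2 * sin y + 2 * (y * cos y) - 2 * sin y by [].
  rewrite !FE !cosN !sinN sinpi cospi; ring.
- move=> x; apply: cvgM; [exact: continuous_cos| exact: exprn_continuous].
Qed.

End onedim.

(** * Integrals of products and of waves over the box *)

Section prodint.
Context (R : realType).

Lemma integral_box0 (F : 0.-tuple (measurableTypeR R) -> R) :
  \int[lebesgue_tuple R 0]_(t in @box R 0) F t = F [tuple].
Proof.
rewrite (@eq_Rintegral _ _ _ _ _ (cst (F [tuple]))); last by move=> t _; rewrite (tuple0 t).
rewrite Rintegral_cst; last exact: measurable_box.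
by rewrite [X in _ * fine X](lebesgue_tuple_box R 0) expr0 /= mulr1.
Qed.

(** Boundedness rather than continuity of the factors lets the formula apply to
    indicators of hyperplanes. *)
Lemma integral_box_prod d (g : 'I_d -> R -> R) (M : 'I_d -> R) :
  (forall i, measurable_fun setT (g i)) ->
  (forall i x, - pi <= x <= pi -> `|g i x| <= M i) ->
  \int[lebesgue_tuple R d]_(t in @box R d) \prod_i g i (tnth t i) =
  \prod_i \int[lebesgue_measure]_(x in `[- pi, pi]) g i x.
Proof.
elim: d g M => [|d IH] g M mg gM.
  by rewrite integral_box0 !big_ord0.
have mP n (h : 'I_n -> R -> R) : (forall i, measurable_fun setT (h i)) ->
  measurable_fun setT (fun t : n.-tuple (measurableTypeR R) => \prod_i h i (tnth t i)).
  move=> mh; apply: measurable_prod => i _.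
  exact: (measurableT_comp (mh i) (measurable_tnth i)).
have bP n (h : 'I_n -> R -> R) (K : 'I_n -> R) :
    (forall i x, - pi <= x <= pi -> `|h i x| <= K i) ->
  forall t, @box R n t -> `|\prod_i h i (tnth t i)| <= \prod_i K i.
  move=> hK t bt; rewrite normr_prod; apply: ler_prod => i _.
  by rewrite normr_ge0 hK.
rewrite (integral_box_cons (M := \prod_i M i)); last exact: bP; last exact: mP.
rewrite [RHS]big_ord_recl /=.
transitivity (\int[lebesgue_measure]_(x in `[- pi, pi])
   ((\prod_i \int[lebesgue_measure]_(x in `[- pi, pi]) g (lift ord0 i) x) * g ord0 x)).
  apply: eq_Rintegral => x _.
  have <- := IH (fun i => g (lift ord0 i)) (fun i => M (lift ord0 i))
    (fun i => mg _) (fun i y => gM _ y).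
  rewrite mulrC -RintegralZl.
  - apply: eq_Rintegral => t _; rewrite big_ord_recl tnth0 /=; congr (_ * _).
    by apply: eq_bigr => i _; rewrite tnthS.
  - exact: measurable_box.
  - apply: (bounded_integrable_box (M := \prod_i M (lift ord0 i))).
      exact: (mP _ (fun i => g (lift ord0 i))).
    by apply: (bP _ (fun i => g (lift ord0 i)) (fun i => M (lift ord0 i))) => i y;
      exact: gM.
rewrite RintegralZl; [exact: mulrC|exact: measurable_itv|].
exact: bounded_integrable_itv (mg ord0) (gM ord0).
Qed.

Lemma continuous_bounded_itv (f : R -> R) : continuous f ->
  exists M, forall x, - pi <= x <= pi -> `|f x| <= M.
Proof.
move=> cf.
have /(continuous_compact (continuous_subspaceT cf)) := @segment_compact R (- pi) pi.
move=> /compact_bounded[M [_ Mf]]; exists (M + 1) => x xI.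
apply: (Mf (M + 1)); first by rewrite ltrDl.
by exists x => //=; rewrite in_itv.
Qed.

Lemma integral_box_prod_continuous d (g : 'I_d -> R -> R) :
  (forall i, continuous (g i)) ->
  \int[lebesgue_tuple R d]_(t in @box R d) \prod_i g i (tnth t i) =
  \prod_i \int[lebesgue_measure]_(x in `[- pi, pi]) g i x.
Proof.
move=> cg; have /choice[M gM] := fun i => continuous_bounded_itv (cg i).
by apply: (integral_box_prod (M := M)) => // i; apply: continuous_measurable_fun.
Qed.

Definition tuple_wave d (k : 'I_d -> int) (a : R) (t : d.-tuple (measurableTypeR R)) : R :=
  cos (\sum_i (k i)%:~R * tnth t i + a).

Lemma measurable_tuple_wave d (k : 'I_d -> int) a : measurable_fun setT (tuple_wave k a).
Proof.
apply: (measurableT_comp (f := cos)); first exact: continuous_measurable_fun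
  (@continuous_cos R).
apply: measurable_funD => //; apply: measurable_sum => i.
by apply: measurable_funM => //; exact: measurable_tnth.
Qed.

Lemma sin_int_pi (k : int) : sin (k%:~R * pi) = 0 :> R.
Proof.
have H n : sin (n%:R * pi) = 0 :> R.
  by elim: n => [|n IH]; rewrite ?mul0r ?sin0 // -natr1 mulrDl mul1r sinDpi IH oppr0.
by case: k => n; rewrite ?NegzE ?mulrNz ?mulNr ?sinN -pmulrn H // oppr0.
Qed.

(** The phase is arbitrary so that, in the induction, the first coordinate can be
    absorbed into it. *)
Lemma integral_tuple_wave d (k : 'I_d -> int) (a : R) :
  \int[lebesgue_tuple R d]_(t in @box R d) tuple_wave k a t =
  if [forall i, k i == 0] then cos a * (2 * pi) ^+ d else 0.
Proof.
elim: d k a => [|d IH] k a.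
  rewrite integral_box0 /tuple_wave big_ord0 add0r expr0 mulr1.
  by case: forallP => // -[] [].
rewrite (integral_box_cons (M := 1)); last by move=> t _; exact: cos_max.
  2: exact: measurable_tuple_wave.
transitivity (\int[lebesgue_measure]_(x in `[- pi, pi])
   if [forall i : 'I_d, k (lift ord0 i) == 0] then cos ((k ord0)%:~R * x + a) * (2 * pi)
     ^+ d else 0).
  apply: eq_Rintegral => x _; rewrite -IH; apply: eq_Rintegral => t _.
  rewrite /tuple_wave big_ord_recl tnth0; congr cos.
  rewrite addrCA addrA; congr (_ + _); congr (_ + _).
  by apply: eq_bigr => i _; rewrite tnthS.
case: (boolP [forall i : 'I_d, k (lift ord0 i) == 0]) => [/forallP k0|kN0].
  transitivity (\int[lebesgue_measure]_(x in `[- pi, pi])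
      ((2 * pi) ^+ d * cos ((k ord0)%:~R * x + a))).
    by apply: eq_Rintegral => x _; rewrite mulrC.
  rewrite RintegralZl; last 2 first.
  - exact: measurable_itv.
  - apply: (bounded_integrable_itv (M := 1)); last by move=> x _; exact: cos_max.
    apply: (measurableT_comp (f := cos));
      first exact: continuous_measurable_fun (@continuous_cos R).
    by apply: measurable_funD => //; apply: measurable_funM.
  have [k00|k00] := eqVneq (k ord0) 0.
    have -> : [forall i, k i == 0].
      by apply/forallP => i; case: (unliftP ord0 i) => [j|] ->; rewrite ?k0 ?k00.
    under eq_Rintegral do rewrite k00 mul0r add0r.
    rewrite Rintegral_cst; last exact: measurable_itv.
    by rewrite [X in fine X](lebesgue_itv_pi R) exprS /=; ring.
  have -> : [forall i, k i == 0] = false by apply/negP => /forallP/(_ ord0);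
    rewrite (negPf k00).
  by rewrite integral_cos_freq ?mulr0 ?intr_eq0 // sin_int_pi.
rewrite ifF; last by apply: contraNF kN0 => /forallP k0; apply/forallP.
by rewrite Rintegral_cst // mul0r.
Qed.

(** Periodicity identifies the faces [v_i = - pi] and [v_i = pi], so an arc meets
    the box in a slab only up to the points of a face. *)
Lemma null_face d (i : 'I_d) (c : R) :
  lebesgue_tuple R d (@box R d `&` [set t | tnth t i = c]) = 0%E.
Proof.
have mS : measurable [set t : d.-tuple (measurableTypeR R) | tnth t i = c].
  rewrite [X in measurable X](_ : _ = setT `&` (fun t => tnth t i) @^-1` [set c]);
    last by rewrite setTI.
  exact: measurable_tnth.
have mB := @measurable_box R d.
pose g (j : 'I_d) : R -> R := if j == i then \1_[set c] else cst 1.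
have := @integral_box_prod d g (fun=> 1).
have -> : \prod_j \int[lebesgue_measure]_(x in `[- pi, pi]) g j x = 0.
  rewrite (bigD1 i) //= /g eqxx /Rintegral.
  rewrite integral_indic // [X in fine X](_ : _ = 0%E) ?mul0r //.
  apply/eqP; rewrite eq_le measure_ge0 andbT.
  by rewrite -(lebesgue_measure_set1 c); apply: le_measure; rewrite ?inE //;
    exact: measurableI.
move=> H.
have {H} : \int[lebesgue_tuple R d]_(t in @box R d) (\1_[set t | tnth t i = c] t) = 0 :> R.
  rewrite -{}H.
  - apply: eq_Rintegral => t _; rewrite (bigD1 i) //= big1 ?mulr1 /g ?eqxx.
      by rewrite !indicE; congr (nat_of_bool _)%:R; apply/idP/idP; rewrite !inE.
    by move=> j /negPf ->.
  - move=> j; rewrite /g; case: (j == i); first exact: measurable_indic.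
    exact: measurable_cst.
  - move=> j x _; rewrite /g; case: (j == i) => /=; last by rewrite normr1.
    by rewrite indicE; case: (_ \in _); rewrite ?normr1 ?normr0.
rewrite /Rintegral integral_indic // setIC => /eqP.
rewrite fine_eq0; first by move/eqP.
rewrite ge0_fin_numE //; apply: le_lt_trans (box_lty R d).
by apply: le_measure; rewrite ?inE //; apply: measurableI.
Qed.

End prodint.

(** * The pre-Hilbert space of square-integrable functions *)

Section l2.
Context (R : realType) (d : nat).
Implicit Types (f g h : 'rV[R]_d -> R).
Local Notation mu := (lebesgue_tuple R d).
Local Notation B := (@box R d).
Local Notation tup := (d.-tuple (measurableTypeR R)).

Definition measurable_row f := measurable_fun [set: tup] (f \o @row_of R d).

Definition square_integrable f := measurable_row f /\
  mu.-integrable B (fun t => ((f (row_of t)) ^+ 2)%:E).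

Lemma L2p_square_integrable f : L2p f -> square_integrable f.
Proof. by case. Qed.

Let mB : measurable B := @measurable_box R d.

Lemma integrable_mul f g : square_integrable f -> square_integrable g ->
  mu.-integrable B (EFin \o (fun t => f (row_of t) * g (row_of t))).
Proof.
move=> [mf If] [mg Ig].
apply: (le_integrable mB _ _ (integrableD mB If Ig)).
  by apply/measurable_EFinP; apply: measurable_funTS; apply: measurable_funM.
move=> t _ /=; rewrite lee_fin [leRHS]ger0_norm; last by rewrite addr_ge0 ?sqr_ge0.
rewrite ler_norml; set a := f _; set b := g _.
have := sqr_ge0 (a + b); have := sqr_ge0 (a - b); have := sqr_ge0 a; have := sqr_ge0 b.
by move=> h1 h2 h3 h4; apply/andP; split; nra.
Qed.

Lemma bounded_square_integrable f (M : R) : measurable_row f ->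
  (forall t, B t -> `|f (row_of t)| <= M) -> square_integrable f.
Proof.
move=> mf fM; split => //.
apply: (bounded_integrable_box (M := M ^+ 2)); first exact: measurable_funX.
by move=> t bt; rewrite normrX ler_sqr ?nnegrE ?fM // (le_trans _ (fM _ bt)).
Qed.

Lemma square_integrable_cst (c : R) : square_integrable (fun=> c).
Proof.
apply: (bounded_square_integrable (M := `|c|)) => //.
exact: measurable_cst.
Qed.

Lemma square_integrableD f g : square_integrable f -> square_integrable g ->
  square_integrable (fun v => f v + g v).
Proof.
move=> [mf If] [mg Ig]; split; first exact: measurable_funD.
have I2 := integrableZl mB 2 (integrableD mB If Ig).
apply: (le_integrable mB _ _ I2).
  by apply/measurable_EFinP; apply: measurable_funTS; apply: measurable_funX;
    apply: measurable_funD.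
move=> t _ /=; rewrite lee_fin.
set a := f _; set b := g _.
rewrite !ger0_norm ?sqr_ge0 ?mulr_ge0 ?addr_ge0 ?sqr_ge0 //.
by have := sqr_ge0 (a - b); nra.
Qed.

Lemma square_integrableZ (c : R) f : square_integrable f ->
  square_integrable (fun v => c * f v).
Proof.
move=> [mf If]; split; first exact: measurable_funM.
have := integrableZl mB (c ^+ 2) If; apply: eq_integrable => //.
by move=> t _ /=; rewrite -EFinM exprMn.
Qed.

Lemma square_integrableB f g : square_integrable f -> square_integrable g ->
  square_integrable (fun v => f v - g v).
Proof.
move=> sf sg; have := square_integrableD sf (square_integrableZ (-1) sg).
by congr square_integrable; apply/funext => v; rewrite mulN1r.
Qed.

Lemma square_integrable_sum (I : eqType) (s : seq I) (c : I -> R) (F : I -> 'rV[R]_d -> R) :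
  (forall i, i \in s -> square_integrable (F i)) ->
  square_integrable (fun v => \sum_(i <- s) c i * F i v).
Proof.
elim: s => [|i s IH] sF.
  have := square_integrable_cst 0; congr square_integrable.
  by apply/funext => v; rewrite big_nil.
have := square_integrableD (square_integrableZ (c i) (sF i (mem_head _ _)))
   (IH (fun j js => sF j (mem_behead (s := i :: s) js))).
by congr square_integrable; apply/funext => v; rewrite big_cons.
Qed.

Lemma innerC f g : inner f g = inner g f.
Proof. by apply: eq_Rintegral => t _; rewrite mulrC. Qed.

Lemma innerDl f g h : square_integrable f -> square_integrable g ->
  square_integrable h -> inner (fun v => f v + g v) h = inner f h + inner g h.
Proof.
move=> sf sg sh; rewrite /inner /box_integral.
rewrite -(RintegralD mB (integrable_mul sf sh) (integrable_mul sg sh)).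
by apply: eq_Rintegral => t _; rewrite mulrDl.
Qed.

Lemma innerZl (c : R) f h : square_integrable f ->
  square_integrable h -> inner (fun v => c * f v) h = c * inner f h.
Proof.
move=> sf sh; rewrite /inner /box_integral.
rewrite -(RintegralZl _ mB (integrable_mul sf sh)).
by apply: eq_Rintegral => t _; rewrite mulrA.
Qed.

Lemma innerBl f g h : square_integrable f -> square_integrable g ->
  square_integrable h -> inner (fun v => f v - g v) h = inner f h - inner g h.
Proof.
move=> sf sg sh; rewrite /inner /box_integral.
rewrite -(RintegralB mB (integrable_mul sf sh) (integrable_mul sg sh)).
by apply: eq_Rintegral => t _; rewrite mulrBl.
Qed.

Lemma innerBr f g h : square_integrable f -> square_integrable g ->
  square_integrable h -> inner h (fun v => f v - g v) = inner h f - inner h g.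
Proof. by move=> sf sg sh; rewrite innerC innerBl // !(innerC h). Qed.

Lemma innerDr f g h : square_integrable f -> square_integrable g ->
  square_integrable h -> inner h (fun v => f v + g v) = inner h f + inner h g.
Proof. by move=> sf sg sh; rewrite innerC innerDl // !(innerC h). Qed.

Lemma innerZr (c : R) f h : square_integrable f ->
  square_integrable h -> inner h (fun v => c * f v) = c * inner h f.
Proof. by move=> sf sh; rewrite innerC innerZl // !(innerC h). Qed.

Lemma inner0l h : inner (fun=> 0) h = 0.
Proof.
rewrite /inner /box_integral (@eq_Rintegral _ _ _ _ _ (cst 0)).
  by rewrite Rintegral_cst // mul0r.
by move=> t _; rewrite mul0r.
Qed.

Lemma inner_suml (I : eqType) (s : seq I) (c : I -> R) (F : I -> 'rV[R]_d -> R) h :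
  (forall i, i \in s -> square_integrable (F i)) -> square_integrable h ->
  inner (fun v => \sum_(i <- s) c i * F i v) h = \sum_(i <- s) c i * inner (F i) h.
Proof.
move=> + sh; elim: s => [|i s IH] sF.
  by rewrite big_nil -[RHS](inner0l h); congr (inner _ h); apply/funext => v;
    rewrite big_nil.
have sF' j (js : j \in s) := sF j (mem_behead (s := i :: s) js).
have sFi := sF i (mem_head i s).
rewrite big_cons -(IH sF') -(innerZl _ sFi sh).
rewrite -(innerDl (square_integrableZ _ sFi) (square_integrable_sum _ sF') sh).
by apply: eq_Rintegral => t _; rewrite big_cons.
Qed.

Lemma inner_sumr (I : eqType) (s : seq I) (c : I -> R) (F : I -> 'rV[R]_d -> R) h :
  (forall i, i \in s -> square_integrable (F i)) -> square_integrable h ->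
  inner h (fun v => \sum_(i <- s) c i * F i v) = \sum_(i <- s) c i * inner h (F i).
Proof.
move=> sF sh; rewrite innerC inner_suml //.
by apply: eq_bigr => i _; rewrite innerC.
Qed.

Lemma inner_ge0 f : 0 <= inner f f.
Proof. by apply: Rintegral_ge0 => t _; rewrite -expr2 sqr_ge0. Qed.

Lemma sqr_L2norm f : L2norm f ^+ 2 = inner f f.
Proof. by rewrite sqr_sqrtr ?inner_ge0. Qed.

Lemma L2norm_ge0 f : 0 <= L2norm f.
Proof. exact: sqrtr_ge0. Qed.

Lemma inner_subsub f g : square_integrable f -> square_integrable g ->
  inner (fun v => f v - g v) (fun v => f v - g v) =
  inner f f - 2 * inner f g + inner g g.
Proof.
move=> sf sg; have sfg := square_integrableB sf sg.
by rewrite innerBl // !innerBr // (innerC g f); ring.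
Qed.

Lemma inner_addadd f g : square_integrable f -> square_integrable g ->
  inner (fun v => f v + g v) (fun v => f v + g v) =
  inner f f + 2 * inner f g + inner g g.
Proof.
move=> sf sg; have sfg := square_integrableD sf sg.
by rewrite innerDl // !innerDr // (innerC g f); ring.
Qed.

Lemma CauchySchwarz f g : square_integrable f -> square_integrable g ->
  `|inner f g| <= L2norm f * L2norm g.
Proof.
move=> sf sg.
have H c : 0 <= inner f f - 2 * c * inner f g + c ^+ 2 * inner g g.
  have scg := square_integrableZ c sg.
  have := inner_ge0 (fun v => f v - c * g v).
  by rewrite inner_subsub // innerZl // !innerZr // expr2 !mulrA (mulrC _ c).
rewrite -ler_sqr ?nnegrE ?mulr_ge0 ?L2norm_ge0 //.
rewrite real_normK ?num_real // exprMn !sqr_L2norm.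
have [g0|g0] := eqVneq (inner g g) 0.
  rewrite g0 mulr0; have [->|fg0] := eqVneq (inner f g) 0; first by rewrite expr0n.
  (* The bound in [H] is affine in its parameter when [g] has norm zero, and this
     value makes it [-1]. *)
  have := H ((inner f f + 1) / (2 * inner f g)).
  rewrite g0 mulr0 addr0.
  have -> : 2 * ((inner f f + 1) / (2 * inner f g)) * inner f g = inner f f + 1 by field.
  by rewrite opprD addrA subrr sub0r oppr_ge0 ler10.
have gp : 0 < inner g g by rewrite lt_neqAle eq_sym g0 inner_ge0.
have := H (inner f g / inner g g).
have -> : inner f f - 2 * (inner f g / inner g g) * inner f g +
   (inner f g / inner g g) ^+ 2 * inner g g =
     inner f f - inner f g ^+ 2 / inner g g by field.
by rewrite subr_ge0 ler_pdivrMr.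
Qed.

Lemma L2norm_triangle f g : square_integrable f -> square_integrable g ->
  L2norm (fun v => f v + g v) <= L2norm f + L2norm g.
Proof.
move=> sf sg; rewrite -ler_sqr ?nnegrE ?addr_ge0 ?L2norm_ge0 //.
rewrite sqr_L2norm inner_addadd // sqrrD !sqr_L2norm.
have := le_trans (ler_norm _) (CauchySchwarz sf sg); lra.
Qed.

Lemma L2normZ c f : square_integrable f -> L2norm (fun v => c * f v) = `|c| * L2norm f.
Proof.
move=> sf; rewrite /L2norm innerZl ?innerZr //; last exact: square_integrableZ.
by rewrite mulrA -expr2 sqrtrM ?sqr_ge0 // sqrtr_sqr.
Qed.

End l2.

(** * Real waves *)

Section waves.
Context (R : realType) (d : nat).
Implicit Types (f g h : 'rV[R]_d -> R) (k l : {ffun 'I_d -> int}) (a b : R) (v : 'rV[R]_d).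

(** A single real family for cosines and sines: differentiation and passage to
    conjugate frequencies act on the phase, so no parity of the order of
    differentiation has to be distinguished. The sine is the phase
    [- (pi / 2)]. *)
Definition wave k a v : R := cos (\sum_i (k i)%:~R * v 0 i + a).

Lemma wave_row k a (t : d.-tuple (measurableTypeR R)) : wave k a (row_of t) =
  tuple_wave k a t.
Proof. by congr (cos (_ + _)); apply: eq_bigr => i _; rewrite mxE. Qed.

Lemma measurable_wave k a : measurable_row (wave k a).
Proof.
rewrite /measurable_row (_ : _ \o _ = tuple_wave k a); first exact: measurable_tuple_wave.
by apply/funext => t; rewrite -wave_row.
Qed.

Lemma wave_bound k a v : `|wave k a v| <= 1.
Proof. exact: cos_max. Qed.

Lemma square_integrable_wave k a : square_integrable (wave k a).
Proof.
by apply: (bounded_square_integrable (M := 1)) (measurable_wave k a) _ => t _;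
  exact: wave_bound.
Qed.
Hint Resolve square_integrable_wave : core.

Lemma wave_freqD k l v :
  \sum_i ((k + l) i)%:~R * v 0 i = \sum_i (k i)%:~R * v 0 i + \sum_i (l i)%:~R * v 0 i :> R.
Proof. by rewrite -big_split; apply: eq_bigr => i _; rewrite ffunE rmorphD mulrDl. Qed.

Lemma wave_freqN k v :
  \sum_i ((- k) i)%:~R * v 0 i = - \sum_i (k i)%:~R * v 0 i :> R.
Proof. by rewrite -sumrN; apply: eq_bigr => i _; rewrite ffunE rmorphN mulNr. Qed.

Lemma waveN k a v : wave (- k) a v = wave k (- a) v.
Proof. by rewrite /wave wave_freqN -cosN; congr cos; ring. Qed.

Lemma waveM k l a b v : wave k a v * wave l b v =
  2^-1 * wave (k + l) (a + b) v + 2^-1 * wave (k - l) (a - b) v.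
Proof.
rewrite /wave !wave_freqD wave_freqN; set x := \sum_i _; set y := \sum_i _.
rewrite (_ : x + y + (a + b) = (x + a) + (y + b)); last by ring.
rewrite (_ : x - y + (a - b) = (x + a) - (y + b)); last by ring.
by move: (x + a) (y + b) => p q; rewrite cosD cosB; field.
Qed.

Lemma waveE k a v : wave k a v = cos a * wave k 0 v + (- sin a) * wave k (- (pi / 2)) v.
Proof. by rewrite /wave addr0 cosBpihalf cosD; ring. Qed.

Lemma integral_wave k a : box_integral (wave k a) = (k == 0)%:R * (cos a * (2 * pi) ^+ d).
Proof.
rewrite /box_integral (@eq_Rintegral _ _ _ _ _ (tuple_wave k a)); last by move=> t _;
  exact: wave_row.
rewrite integral_tuple_wave; case: ifPn => [/forallP k0|/forallPn[i k0]].
  suff -> : k = 0 by rewrite eqxx mul1r.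
  by apply/ffunP => i; rewrite ffunE; exact/eqP/k0.
rewrite (_ : (k == 0) = false) ?mul0r //; apply: contraNF k0 => /eqP ->.
by rewrite ffunE.
Qed.

Lemma inner_wave k l a b : inner (wave k a) (wave l b) =
  2^-1 * (2 * pi) ^+ d * ((k == - l)%:R * cos (a + b) + (k == l)%:R * cos (a - b)).
Proof.
have H m c : \int[lebesgue_tuple R d]_(t in @box R d) (2^-1 * wave m c (row_of t)) =
    2^-1 * ((m == 0)%:R * (cos c * (2 * pi) ^+ d)).
  rewrite -integral_wave -RintegralZl //; first exact: measurable_box.
  by apply: (bounded_integrable_box (M := 1));
    [exact: measurable_wave|move=> t _; exact: wave_bound].
rewrite /inner /box_integral.
rewrite (@eq_Rintegral _ _ _ _ _ (fun t => 2^-1 * wave (k + l) (a + b) (row_of t) + 2^-1 *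
  wave (k - l) (a - b) (row_of t))); last by move=> t _; exact: waveM.
have I m c : (lebesgue_tuple R d).-integrable (@box R d)
  (EFin \o (fun t => 2^-1 * wave m c (row_of t))).
  apply: (bounded_integrable_box (M := 2^-1)); first by apply: measurable_funM => //;
    exact: measurable_wave.
  by move=> t _; rewrite normrM ger0_norm // ler_piMr // wave_bound.
rewrite (RintegralD (@measurable_box R d) (I _ _) (I _ _)) !H subr_eq0 addr_eq0; ring.
Qed.

(** Along a coordinate line the wave is the cosine of an affine function of one
    real variable, with the same difference quotients. *)
Lemma is_derive_wave k a v i : is_derive v (coord_vec R i) (wave k a)
  ((k i)%:~R * wave k (a + pi / 2) v).
Proof.
pose x0 := \sum_j (k j)%:~R * v 0 j + a.
pose F : R -> R := cos \o ((k i)%:~R \*: id + cst x0).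
have dF : is_derive (0 : R) (1 : R) F (- (k i)%:~R * sin x0).
  apply: is_derive_eq; rewrite !fctE /cst /GRing.scale /= /GRing.scale /= mulr0 add0r; ring.
have E : (fun h : R => h^-1 *: ((wave k a \o shift v) (h *: coord_vec R i) - wave k a v)) =
  (fun h : R => h^-1 *: ((F \o shift 0) (h *: 1) - F 0)).
  apply/funext => h; congr (_ *: (_ - _)); rewrite /F /= /wave.
    congr cos; rewrite addr0 !fctE /= /GRing.scale /= mulr1 /x0 addrA; congr (_ + _).
    transitivity (\sum_j ((k j)%:~R * (h * (i == j)%:R) + (k j)%:~R * v 0 j)).
      by apply: eq_bigr => j _; rewrite !mxE eqxx /= mulrDr eq_sym.
    rewrite big_split /=; congr (_ + _); rewrite (bigD1 i) //= eqxx big1 ?addr0 ?mulr1 //.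
    by move=> j /negPf ji; rewrite eq_sym ji !mulr0.
  by rewrite !fctE /= /GRing.scale /= mulr0 add0r.
apply: DeriveDef.
  by rewrite /derivable E; have [] := dF.
rewrite /derive E; have [_] := dF; rewrite /derive => ->.
by rewrite /wave addrA cosDpihalf -/x0; ring.
Qed.

Lemma continuous_wave k a : continuous (wave k a).
Proof.
have cf : continuous (fun v : 'rV[R]_d => \sum_i (k i)%:~R * v 0 i).
  apply: continuous_big => [|i _]; first exact: add_continuous.
  move=> v; apply: (continuous_comp (f := fun v : 'rV[R]_d => v 0 i)
    (g := *%R (k i)%:~R)); first exact: coord_continuous.
  exact: mulrl_continuous.
move=> v; apply: (continuous_comp (f := fun v => \sum_i (k i)%:~R * v 0 i)
  (g := fun x => cos (x + a))); first exact: cf.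
apply: (continuous_comp (f := +%R^~ a) (g := cos)); last exact: continuous_cos.
by apply: cvgD; [exact: cvg_id|exact: cvg_cst].
Qed.

Lemma partials_wave k a (s : seq 'I_d) : partials s (wave k a) =
  (fun v => (\prod_(i <- s) (k i)%:~R) * wave k (a + (size s)%:R * (pi / 2)) v).
Proof.
elim: s => [|i s IH] /=.
  by apply/funext => v; rewrite big_nil mul1r mul0r addr0.
rewrite IH; apply/funext => v; rewrite big_cons.
have D := is_derive_wave k (a + (size s)%:R * (pi / 2)) v i.
set c := \prod_(_ <- _) _.
have -> : (fun v => c * wave k (a + (size s)%:R * (pi / 2)) v) = c \*:
  wave k (a + (size s)%:R * (pi / 2)) by [].
rewrite deriveZ; last by have [] := D.
have -> : a + (size s).+1%:R * (pi / 2) = a + (size s)%:R * (pi / 2) + pi / 2.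
  by rewrite -natr1; ring.
by have [_ ->] := D; rewrite /GRing.scale /=; ring.
Qed.

Lemma smooth_wave k a : smooth (wave k a).
Proof.
move=> s; rewrite partials_wave; split.
  move=> v; apply: (continuous_comp (f := wave k _)
    (g := *%R (\prod_(i <- s) (k i)%:~R))); first exact: continuous_wave.
  exact: mulrl_continuous.
move=> i v; apply: derivableZ.
by have [] := is_derive_wave k (a + (size s)%:R * (pi / 2)) v i.
Qed.

Lemma cosD2pi_int (m : int) x : cos (x + m%:~R * (2 * pi)) = cos x :> R.
Proof.
have H n y : cos (y + n%:R * (2 * pi)) = cos y :> R.
  elim: n y => [|n IH] y; first by rewrite mul0r addr0.
  rewrite -natr1 -[RHS]IH -[RHS]cosD2pi; congr cos.
  by rewrite -mulr_natl; ring.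
case: m => n; first by rewrite -pmulrn H.
by rewrite NegzE mulrNz mulNr -pmulrn -[LHS](H n.+1) subrK.
Qed.

Lemma periodic_wave k a : box_periodic (wave k a).
Proof.
move=> i v; rewrite /wave -[RHS](cosD2pi_int (k i)); congr cos.
rewrite addrAC; congr (_ + _).
rewrite (bigD1 i) //= [in RHS](bigD1 i) //= !mxE !eqxx /= mulr1 mulrDr -!addrA;
  congr (_ + _).
rewrite addrC; congr (_ + _); apply: eq_bigr => j ji.
by rewrite !mxE (negPf ji) /= mulr0 addr0.
Qed.

End waves.

(** * Trigonometric polynomials as combinations of waves *)

Section trig.
Local Open Scope complex_scope.
Context (R : realType) (d : nat).
Implicit Types (f g h : 'rV[R]_d -> R) (k l : {ffun 'I_d -> int}) (a b : R) (v : 'rV[R]_d).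

(** The integer frequency vector behind the shifted indices that enumerate the
    exponentials of degree at most [N]. *)
Definition freq N (x : {ffun 'I_d -> 'I_N.*2.+1}) : {ffun 'I_d -> int} :=
  [ffun i => (x i : nat)%:Z - N%:Z].

Lemma phaseE N (x : {ffun 'I_d -> 'I_N.*2.+1}) v :
  phase x v = \sum_i (freq x i)%:~R * v 0 i.
Proof. by apply: eq_bigr => i _; rewrite ffunE rmorphB. Qed.

Lemma freq_inj N : injective (@freq N).
Proof.
move=> x y /ffunP E; apply/ffunP => i; apply/val_inj/eqP.
by have /eqP := E i; rewrite !ffunE (inj_eq (addIr _)).
Qed.

Lemma freq_surj N k : (forall i, (`|k i| <= N)%N) -> exists x : {ffun 'I_d -> 'I_N.*2.+1},
  freq x = k.
Proof.
move=> kN; exists [ffun i => inord (absz (k i + N%:Z))].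
apply/ffunP => i; rewrite !ffunE; have := kN i; move: (k i) => m mN.
rewrite inordK -?addnn; lia.
Qed.

Lemma freq_bound N (x : {ffun 'I_d -> 'I_N.*2.+1}) i : (`|freq x i| <= N)%N.
Proof. by rewrite ffunE; have := ltn_ord (x i); lia. Qed.

Definition freqs N : seq {ffun 'I_d -> int} := codom (@freq N).

Lemma freqs_uniq N : uniq (freqs N).
Proof. by rewrite map_inj_uniq ?enum_uniq //; exact: freq_inj. Qed.

Lemma mem_freqs N k : (k \in freqs N) = [forall i, (`|k i| <= N)%N].
Proof.
apply/codomP/forallP => [[x ->] i|kN]; first exact: freq_bound.
by have [x <-] := freq_surj kN; exists x.
Qed.

Lemma freqs_opp N k : (- k \in freqs N) = (k \in freqs N).
Proof. by rewrite !mem_freqs; apply: eq_forallb => i; rewrite ffunE abszN. Qed.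

Lemma trig_polyD N g h : trig_poly N g -> trig_poly N h -> trig_poly N (fun v => g v + h v).
Proof.
move=> [c gc] [e he]; exists (fun x => c x + e x) => v.
rewrite (rmorphD (real_complex R)) /= gc he -big_split; apply: eq_bigr => x _;
  exact/esym/mulrDl.
Qed.

Lemma trig_polyZ N t g : trig_poly N g -> trig_poly N (fun v => t * g v).
Proof.
move=> [c gc]; exists (fun x => t%:C * c x) => v.
rewrite (rmorphM (real_complex R)) /= gc mulr_sumr; apply: eq_bigr => x _; exact: mulrA.
Qed.

Lemma trig_poly0 N : trig_poly N (fun _ : 'rV[R]_d => 0).
Proof. by exists (fun=> 0) => v; rewrite big1 // => x _; rewrite mul0r. Qed.

Lemma trig_poly_sum N (I : eqType) (s : seq I) (c : I -> R) (F : I -> 'rV[R]_d -> R) :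
  (forall i, i \in s -> trig_poly N (F i)) ->
    trig_poly N (fun v => \sum_(i <- s) c i * F i v).
Proof.
elim: s => [|i s IH] sF.
  have := trig_poly0 N; congr trig_poly.
  by apply/funext => v; rewrite big_nil.
have := trig_polyD (trig_polyZ (c i) (sF i (mem_head _ _)))
   (IH (fun j js => sF j (mem_behead (s := i :: s) js))).
by congr trig_poly; apply/funext => v; rewrite big_cons.
Qed.

(** Half the sum of the exponentials at the frequencies [k] and [- k], with phases
    [a] and [- a]; when [k] is zero, both terms fall on the same coefficient. *)
Lemma trig_poly_wave N k a : (forall i, (`|k i| <= N)%N) -> trig_poly N (wave k a).
Proof.
move=> kN; have [x xk] := freq_surj kN.
have [y yk] : exists y : {ffun 'I_d -> 'I_N.*2.+1}, freq y = - k.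
  by apply: freq_surj => i; rewrite ffunE abszN.
exists (fun z => (z == x)%:R * (2^-1%:C * expi a) + (z == y)%:R * (2^-1%:C * expi (- a)))
  => v.
have pick u (e : R[i]) : \sum_z ((z == u)%:R * e) * expi (phase z v) = e * expi (phase u v).
  rewrite (bigD1 u) //= eqxx mul1r big1 ?addr0 // => z /negPf ->.
  by rewrite !mul0r.
under eq_bigr do rewrite mulrDl.
rewrite big_split /= !pick !phaseE xk yk wave_freqN /wave.
set p := \sum_i _; rewrite /expi cosD !cosN !sinN.
apply/eqP; rewrite eq_complex /=; by apply/andP; split; apply/eqP; field.
Qed.

Definition basis_wave N (x : bool * {ffun 'I_d -> 'I_N.*2.+1}) : 'rV[R]_d -> R :=
  wave (freq x.2) (if x.1 then - (pi / 2) else 0).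

(** Real parts of both sides: the complex coefficient contributes its real part
    to a cosine and minus its imaginary part to a sine. *)
Lemma trig_polyE N g : trig_poly N g ->
  exists c : bool * {ffun 'I_d -> 'I_N.*2.+1} -> R,
    g = fun v => \sum_(x <- index_enum _) c x * basis_wave x v.
Proof.
move=> [c gc]; exists (fun x => if x.1 then - complex.Im (c x.2) else complex.Re (c x.2)).
apply/funext => v; have /(congr1 (@complex.Re R)) /= -> := gc v.
rewrite raddf_sum /=.
rewrite -(pair_bigA _ (fun (e : bool) x => (if e then - complex.Im (c x) else complex.Re
  (c x)) * basis_wave (e, x) v)) /=.
rewrite big_bool /= -big_split /=; apply: eq_bigr => x _.
rewrite /basis_wave /wave /= addr0 cosBpihalf -phaseE.
by case: (c x) => p q; rewrite /expi /=; ring.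
Qed.

End trig.

(** * Orthogonal projection onto a finite-dimensional space *)

Section span.
Context (R : realType) (d : nat) (I : Type) (F : I -> 'rV[R]_d -> R).
Implicit Types (f g h : 'rV[R]_d -> R) (s : seq I).
Hypothesis sF : forall i, square_integrable (F i).

(** Defined by recursion so that vectors can be adjoined one at a time. *)
Fixpoint span s : set ('rV[R]_d -> R) :=
  if s is i :: s' then
    [set g | exists t h, span s' h /\ g = (fun v => t * F i v + h v)]
  else [set (fun=> 0)].

Lemma span_square_integrable s g : span s g -> square_integrable g.
Proof.
elim: s g => [|i s IH] g /= => [->|[t [h [/IH sh ->]]]]; first exact: square_integrable_cst.
by apply: square_integrableD => //; apply: square_integrableZ.
Qed.

Lemma spanD s g h : span s g -> span s h -> span s (fun v => g v + h v).
Proof.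
elim: s g h => [|i s IH] g h /=; first by move=> -> ->; apply/funext => v; rewrite addr0.
move=> [t [g' [sg ->]]] [u [h' [sh ->]]]; exists (t + u), (fun v => g' v + h' v).
by split; [exact: IH|apply/funext => v; ring].
Qed.

Lemma spanZ s c g : span s g -> span s (fun v => c * g v).
Proof.
elim: s g => [|i s IH] g /=; first by move=> ->; apply/funext => v; rewrite mulr0.
move=> [t [g' [sg ->]]]; exists (c * t), (fun v => c * g' v).
by split; [exact: IH|apply/funext => v; ring].
Qed.

Lemma span_sum s (c : I -> R) : span s (fun v => \sum_(i <- s) c i * F i v).
Proof.
elim: s => [|i s IH] /=; first by apply/funext => v; rewrite big_nil.
exists (c i), (fun v => \sum_(i <- s) c i * F i v).
by split => //; apply/funext => v; rewrite big_cons.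
Qed.

Lemma span_ind (P : set ('rV[R]_d -> R)) s : P (fun=> 0) ->
  (forall t i h, P h -> P (fun v => t * F i v + h v)) -> span s `<=` P.
Proof.
move=> P0 PF; elim: s => [|i s IH] g /=; first by move=> ->.
by move=> [t [h [/IH Ph ->]]]; exact: PF.
Qed.

(** Gram-Schmidt: the residual [e] of a new vector after projection onto the
    earlier ones is the only new direction. *)
Lemma span_projection s f : square_integrable f ->
  exists2 g, span s g & forall h, span s h -> inner (fun v => f v - g v) h = 0.
Proof.
elim: s f => [|i s IH] f sf.
  by exists (fun=> 0) => // h ->; rewrite innerC inner0l.
have [q sq fq] := IH f sf; have [p sp Fp] := IH (F i) (sF i).
have Sq := span_square_integrable sq; have Sp := span_square_integrable sp.
pose e v := F i v - p v; have Se : square_integrable e := square_integrableB (sF i) Sp.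
have Sfq := square_integrableB sf Sq.
pose t := inner (fun v => f v - q v) e / inner e e.
(* If [e] has norm zero, [t] is zero by the convention on division by zero, and
   the equation holds by Cauchy-Schwarz. *)
have te : t * inner e e = inner (fun v => f v - q v) e.
  rewrite /t; have [e0|e0] := eqVneq (inner e e) 0; last by rewrite divfK.
  have := CauchySchwarz Sfq Se.
  by rewrite [L2norm e]/L2norm e0 sqrtr0 mulr0 normr_le0 mulr0 => /eqP ->.
pose g v := q v + t * e v.
have Sg : square_integrable g by apply: square_integrableD => //; apply: square_integrableZ.
have Sfg := square_integrableB sf Sg.
have fgE : (fun v => f v - g v) = (fun v => (f v - q v) - t * e v).
  by apply/funext => v; rewrite /g opprD addrA.
have fg_s h : span s h -> inner (fun v => f v - g v) h = 0.
  move=> sh; have Sh := span_square_integrable sh.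
  rewrite fgE innerBl //; last exact: square_integrableZ.
  by rewrite fq // innerZl // Fp // mulr0 subr0.
have fg_e : inner (fun v => f v - g v) e = 0.
  rewrite fgE innerBl //; last exact: square_integrableZ.
  by rewrite innerZl // te subrr.
exists g.
  exists t, (fun v => q v + (- t) * p v); split; first by apply: spanD => //; apply: spanZ.
  by apply/funext => v; rewrite /g /e; ring.
move=> h [u [h' [sh ->]]]; have Sh := span_square_integrable sh.
have -> : (fun v => u * F i v + h' v) = (fun v => u * e v + (u * p v + h' v)).
  by apply/funext => v; rewrite /e; ring.
have Sph : span s (fun v => u * p v + h' v) by apply: spanD => //; apply: spanZ.
rewrite (innerDr (square_integrableZ u Se) (span_square_integrable Sph) Sfg).
by rewrite innerZr // fg_e fg_s // mulr0 addr0.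
Qed.

End span.

(** * The algebra of trigonometric polynomials and polynomial steps *)

Section trig_algebra.
Context (R : realType) (d : nat).
Implicit Types (f g h p q : 'rV[R]_d -> R).
Local Notation B := (@box R d).
Local Notation mu := (lebesgue_tuple R d).

Lemma trig_poly_mono N M g : (N <= M)%N -> trig_poly N g -> trig_poly M g.
Proof.
move=> NM /trig_polyE[c ->]; apply: trig_poly_sum => x _; apply: trig_poly_wave => i.
exact: leq_trans (freq_bound _ _) NM.
Qed.

Lemma trig_poly_square_integrable N g : trig_poly N g -> square_integrable g.
Proof.
move=> /trig_polyE[c ->]; apply: square_integrable_sum => x _.
exact: square_integrable_wave.
Qed.

Lemma trig_poly_bounded N g : trig_poly N g -> exists M, forall v, `|g v| <= M.
Proof.
move=> /trig_polyE[c ->]; exists (\sum_(x <- index_enum _) `|c x|) => v.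
apply: le_trans (ler_norm_sum _ _ _) _; apply: ler_sum => x _.
by rewrite normrM ler_piMr // wave_bound.
Qed.

(** Products of waves are sums of waves at the sums and differences of the
    frequencies. *)
Lemma trig_polyM N M g h : trig_poly N g -> trig_poly M h ->
  trig_poly (N + M) (fun v => g v * h v).
Proof.
move=> /trig_polyE[c ->] /trig_polyE[e ->].
pose G x v := \sum_(y <- index_enum _) e y *
  (basis_wave (d := d) (N := N) x v * basis_wave (d := d) (N := M) y v) : R.
have -> : (fun v => (\sum_(x <- index_enum _) c x * basis_wave x v) *
    (\sum_(y <- index_enum _) e y * basis_wave y v)) =
    (fun v => \sum_(x <- index_enum _) c x * G x v).
  apply/funext => v; rewrite mulr_suml; apply: eq_bigr => x _.
  by rewrite -mulrA /G; congr (_ * _); rewrite mulr_sumr; apply: eq_bigr => y _;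
    rewrite mulrCA.
apply: trig_poly_sum => x _; apply: trig_poly_sum => y _.
rewrite (_ : (fun v => _) = (fun v => 2^-1 * wave (freq x.2 + freq y.2)
     ((if x.1 then - (pi / 2) else 0) + (if y.1 then - (pi / 2) else 0)) v + 2^-1 * wave
       (freq x.2 - freq y.2)
    ((if x.1 then - (pi / 2) else 0) - (if y.1 then - (pi / 2) else 0)) v)); last first.
  by apply/funext => v; exact: waveM.
by apply: trig_polyD; apply: trig_polyZ; apply: trig_poly_wave => i;
  have := freq_bound x.2 i; have := freq_bound y.2 i; rewrite !ffunE; lia.
Qed.

Lemma trig_poly_cst (c : R) : trig_poly 0 (fun _ : 'rV[R]_d => c).
Proof.
rewrite (_ : (fun _ => c) = (fun v => c * wave 0 0 v)).
  by apply: trig_polyZ; apply: trig_poly_wave => i; rewrite ffunE.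
apply/funext => v; rewrite /wave big1 ?addr0 ?cos0 ?mulr1 // => i _.
by rewrite ffunE mul0r.
Qed.

Lemma trig_polyX N n g : trig_poly N g -> trig_poly (N * n) (fun v => g v ^+ n).
Proof.
move=> tg; elim: n => [|n IH]; first by rewrite muln0; exact: trig_poly_cst.
rewrite mulnS (_ : (fun v => _) = (fun v => g v * g v ^+ n)); first exact: trig_polyM.
by apply/funext => v; rewrite exprS.
Qed.

Lemma bernoulli_ineq (x : R) n : 0 <= 1 + x -> 1 + n%:R * x <= (1 + x) ^+ n.
Proof.
move=> x1; elim: n => [|n IH]; first by rewrite mul0r addr0 expr0.
rewrite exprS; apply: le_trans (ler_wpM2l x1 IH).
have := sqr_ge0 x; have : 0 <= n%:R :> R by []; rewrite -natr1.
move: (n%:R) => m m0 x2; have : 0 <= m * x ^+ 2 by rewrite mulr_ge0.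
by lra.
Qed.

End trig_algebra.

Section step.
Context (R : realType).

(** The polynomials [(1 - u^m)^(2^m)] on the unit interval tend to [1] where
    [u < 1/2] and to [0] where [u > 1/2], by Bernoulli's inequality.  The map
    below sends the range [-2 <= q <= 2] into the unit interval and the threshold
    [q = 0] to [1/2], with a shift of order [1/n] that puts the threshold itself
    on the side where the limit is [0]; the exponent [m] of order [n^2]
    outweighs the vanishing shift. *)
Definition step_arg (q : R) (n : nat) : R := 2^-1 + (- 8^-1) * q + 8^-1 * n.+1%:R^-1.

Definition step (q : R) (n : nat) : R :=
  (1 - step_arg q n ^+ (n.+1 ^ 2)) ^+ (2 ^ (n.+1 ^ 2)).

Lemma step_arg_itv q n : `|q| <= 2 -> 0 <= step_arg q n <= 1.
Proof.
rewrite ler_norml /step_arg => /andP[q1 q2].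
have : 0 <= n.+1%:R^-1 :> R by []. have : n.+1%:R^-1 <= 1 :> R by rewrite invf_le1 // ler1n.
move: (n.+1%:R^-1) => z z1 z0; apply/andP; split; lra.
Qed.

Lemma step_itv q n : `|q| <= 2 -> 0 <= step q n <= 1.
Proof.
move=> /(step_arg_itv n) /andP[s0 s1].
have h0 : 0 <= step_arg q n ^+ (n.+1 ^ 2) by rewrite exprn_ge0.
have h1 : step_arg q n ^+ (n.+1 ^ 2) <= 1 by rewrite exprn_ile1.
by rewrite /step exprn_ge0 ?exprn_ile1 ?subr_ge0 // lerBlDr lerDl.
Qed.

(** The lower bound is Bernoulli's inequality [(1 - u^m)^(2^m) >= 1 - (2 u)^m]. *)
Lemma step_cvg1 q : `|q| <= 2 -> 0 < q -> step q n @[n --> \oo] --> (1 : R).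
Proof.
move=> q2 q0; have := q2; rewrite ler_norml => /andP[_ q2'].
pose rho : R := 1 - q / 8.
have rho01 : 0 <= rho < 1 by apply/andP; split; rewrite /rho; lra.
apply: (@squeeze_cvgr _ _ _ _ (fun n => 1 - rho ^+ n.+1) (cst 1)).
- near=> n; have /andP[s0 s1] := step_itv n q2; rewrite s1 andbT.
  have /andP[a0 a1] := step_arg_itv n q2.
  have nq : n.+1%:R^-1 <= q / 2.
    near: n; have q20 : 0 < q / 2 by rewrite divr_gt0.
    have := @cvg_harmonic R => /cvgrPdist_le/(_ _ q20); apply: filterS => n /=.
    by rewrite sub0r normrN ger0_norm.
  have ar : 2 * step_arg q n <= rho by rewrite /step_arg /rho; move: nq;
    move: (n.+1%:R^-1) => z; lra.
  rewrite /step; set m := (n.+1 ^ 2)%N; set u := step_arg q n.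
  have u1 : u ^+ m <= 1 by rewrite exprn_ile1.
  have := @bernoulli_ineq R (- (u ^+ m)) (2 ^ m) _; rewrite subr_ge0 => /(_ u1).
  apply: le_trans; rewrite lerD2l mulrN lerN2 natrX -exprMn.
  apply: (le_trans (y := rho ^+ m)); first by rewrite lerXn2r ?nnegrE ?mulr_ge0 //;
    case/andP: rho01.
  by case/andP: rho01 => r0 /ltW r1; rewrite ler_wiXn2l // /m leq_pmulr.
- rewrite -[X in _ --> X]subr0; apply: cvgB; first exact: cvg_cst.
  have := @cvg_expr R rho; rewrite ger0_norm; last by case/andP: rho01.
  case/andP: rho01 => _ r1 /(_ r1) h; by rewrite -(cvg_shiftS _) in h.
- exact: cvg_cst.
Unshelve. all: by end_near. Qed.

(** The upper bound comes from [(1 - x)^M <= (1 + x)^(-M)] and two applications of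
    Bernoulli's inequality: [(1 + u^m)^(2^m) >= (2 u)^m >= (n + 1) / 4]. *)
Lemma step_cvg0 q : `|q| <= 2 -> q <= 0 -> step q n @[n --> \oo] --> (0 : R).
Proof.
move=> q2 q0.
apply: (@squeeze_cvgr _ _ _ _ (cst 0) (fun n => 4 * n.+1%:R^-1)).
- near=> n; have /andP[s0 s1] := step_itv n q2; rewrite s0 /=.
  have /andP[a0 a1] := step_arg_itv n q2.
  have z0 : 0 < n.+1%:R^-1 :> R by rewrite invr_gt0.
  have ar : 1 + 4^-1 * n.+1%:R^-1 <= 2 * step_arg q n.
    by rewrite /step_arg; move: z0; move: (n.+1%:R^-1) => z z0; lra.
  have M : 4^-1 * n.+1%:R <= (2 * step_arg q n) ^+ (n.+1 ^ 2).
    have h1 : 0 <= 1 + 4^-1 * n.+1%:R^-1 :> R by move: z0; move: (n.+1%:R^-1) => z z0; lra.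
    apply: le_trans (lerXn2r _ _ _ ar); rewrite ?nnegrE ?mulr_ge0 //.
    apply: le_trans (bernoulli_ineq _ h1).
    have -> : (n.+1 ^ 2)%:R * (4^-1 * n.+1%:R^-1) = 4^-1 * n.+1%:R :> R.
      have : n.+1%:R != 0 :> R by rewrite pnatr_eq0.
      by rewrite natrX; move: (n.+1%:R : R) => y y0; field.
    by rewrite lerDr.
  move: M; rewrite /step; set m := (n.+1 ^ 2)%N; set u := step_arg q n => M.
  have u1 : u ^+ m <= 1 by rewrite exprn_ile1.
  have u0 : 0 <= u ^+ m by rewrite exprn_ge0.
  have B : 4^-1 * n.+1%:R <= (1 + u ^+ m) ^+ (2 ^ m).
    apply: (le_trans M); rewrite exprMn -natrX.
    have H : 0 <= 1 + u ^+ m by rewrite addr_ge0.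
    by apply: le_trans (bernoulli_ineq _ H); rewrite lerDr.
  have P : (1 - u ^+ m) ^+ (2 ^ m) * (1 + u ^+ m) ^+ (2 ^ m) <= 1.
    rewrite -exprMn exprn_ile1 //.
      by rewrite mulr_ge0 ?subr_ge0 ?addr_ge0.
    by have := sqr_ge0 (u ^+ m); lra.
  have W0 : 0 <= (1 - u ^+ m) ^+ (2 ^ m) by rewrite exprn_ge0 // subr_ge0.
  have P' := le_trans (ler_wpM2l W0 B) P.
  rewrite -(ler_pM2r (ltr0Sn R n)) -mulrA mulVf ?pnatr_eq0 // mulr1.
  move: P'; move: (n.+1%:R : R) ((1 - u ^+ m) ^+ (2 ^ m)) => y w; lra.
- exact: cvg_cst.
- rewrite -[X in _ --> X](mulr0 4); apply: cvgMr; exact: cvg_harmonic.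
Unshelve. all: by end_near. Qed.

End step.

(** * Functions that trigonometric polynomials approximate in mean square *)

Section density.
Context (R : realType) (d : nat).
Implicit Types (f g h p q : 'rV[R]_d -> R).
Local Notation B := (@box R d).
Local Notation mu := (lebesgue_tuple R d).
Local Notation tup := (d.-tuple (measurableTypeR R)).

Let mB : measurable B := @measurable_box R d.

Lemma dominated_square_integrable f g : measurable_row f ->
  (forall t, B t -> `|f (row_of t)| <= g (row_of t)) -> square_integrable g ->
  square_integrable f.
Proof.
move=> mf fg [mg Ig]; split => //; apply: (le_integrable mB _ _ Ig).
  by apply/measurable_EFinP; apply: measurable_funTS; apply: measurable_funX.
move=> t bt /=; rewrite lee_fin !normrX ler_sqr ?nnegrE //.
exact: le_trans (fg t bt) (ler_norm _).
Qed.

Lemma inner_mul_bound u w (c : R) : measurable_row u ->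
  (forall t, B t -> `|u (row_of t)| <= c) -> square_integrable w ->
  square_integrable (fun v => u v * w v) /\
  inner (fun v => u v * w v) (fun v => u v * w v) <= c ^+ 2 * inner w w.
Proof.
move=> mu_ uc sw; have [mw Iw] := sw.
have uw t : B t -> (u (row_of t) * w (row_of t)) ^+ 2 <= c ^+ 2 * w (row_of t) ^+ 2.
  move=> bt; rewrite exprMn ler_wpM2r ?sqr_ge0 // -real_normK ?num_real //.
  by rewrite ler_sqr ?nnegrE ?uc //; apply: le_trans (uc t bt).
have Icw := integrableZl mB (c ^+ 2) Iw.
have suw : square_integrable (fun v => u v * w v).
  split; first exact: measurable_funM.
  apply: (le_integrable mB _ _ Icw).
    by apply/measurable_EFinP; apply: measurable_funTS; apply: measurable_funX;
      apply: measurable_funM.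
  move=> t bt /=; have h1 := sqr_ge0 (u (row_of t) * w (row_of t)).
  by rewrite lee_fin (ger0_norm h1) (ger0_norm (le_trans h1 (uw t bt))) uw.
split => //; rewrite -(innerZl _ sw sw); apply: (le_Rintegral mB).
- exact: (integrable_mul suw suw).
- exact: (integrable_mul (square_integrableZ _ sw) sw).
- by move=> t bt; have := uw t bt; rewrite expr2 !expr2 !mulrA.
Qed.

Lemma inner_addadd_le f g : square_integrable f -> square_integrable g ->
  inner (fun v => f v + g v) (fun v => f v + g v) <= 2 * inner f f + 2 * inner g g.
Proof.
move=> sf sg; rewrite inner_addadd //.
by have := inner_ge0 (fun v => f v - g v); rewrite inner_subsub //; lra.
Qed.

(** Dominated convergence for the squared differences, which are at most
    [4 g^2]. *)
Lemma L2_dominated_cvg (F : nat -> 'rV[R]_d -> R) f g :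
  (forall n, measurable_row (F n)) -> measurable_row f -> square_integrable g ->
  (forall n t, B t -> `|F n (row_of t)| <= g (row_of t)) ->
  (forall t, B t -> `|f (row_of t)| <= g (row_of t)) ->
  {ae mu, forall t, B t -> F n (row_of t) @[n --> \oo] --> f (row_of t)} ->
  forall e, 0 < e -> exists n,
    inner (fun v => f v - F n v) (fun v => f v - F n v) < e.
Proof.
move=> mF mf sg Fg fg Ff e e0; have [mg Ig] := sg.
pose D n (t : tup) := (((f (row_of t) - F n (row_of t)) ^+ 2)%:E).
have mD n : measurable_fun B (D n).
  apply/measurable_EFinP; apply: measurable_funTS; apply: measurable_funX.
  exact: (measurable_funB mf (mF n)).
have I4 := integrableZl mB 4 Ig.
have cvgD : {ae mu, forall t, B t -> D n t @[n --> \oo] --> (cst 0%E : tup -> \bar R) t}.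
  move: Ff; apply: filterS => t /= Ff bt; apply: cvg_EFin; first exact: nearW.
  have Hd : (f (row_of t) - F n (row_of t)) @[n --> \oo] --> (0 : R).
    rewrite -[X in _ --> X](subrr (f (row_of t))).
    by apply: cvgB; [exact: cvg_cst|exact: Ff].
  rewrite -[X in _ --> X](mulr0 (0 : R)); exact: (cvgM Hd Hd).
have domD : {ae mu, forall t n, B t -> (`|D n t| <= 4%:E * ((g (row_of t)) ^+ 2)%:E)%E}.
  apply: aeW => t n bt; rewrite /D /= lee_fin ger0_norm ?sqr_ge0 //.
  have := Fg n t bt; have := fg t bt; rewrite !ler_norml; nra.
have [_ _] := dominated_convergence mB mD (measurable_cst _) cvgD I4 domD.
rewrite integral0 => /fine_cvgP[_] /cvgrPdist_lt/(_ _ e0)[n _ /(_ n (leqnn n))] /=.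
rewrite sub0r normrN => h; exists n; apply: le_lt_trans h.
by apply: le_trans (ler_norm _); rewrite /inner /box_integral /Rintegral /D.
Qed.

(** Membership in the mean-square closure of the trigonometric polynomials of all
    degrees. *)
Definition trig_approx f := forall e : R, 0 < e -> exists N p, trig_poly N p /\
  inner (fun v => f v - p v) (fun v => f v - p v) < e.

Lemma trig_approx_trig N p : trig_poly N p -> trig_approx p.
Proof.
move=> tp e e0; exists N, p; split => //.
rewrite (_ : (fun v => p v - p v) = (fun=> 0)) ?inner0l //.
by apply/funext => v; rewrite subrr.
Qed.

Lemma trig_approx_eq f g : (forall t, B t -> f (row_of t) = g (row_of t)) ->
  trig_approx f -> trig_approx g.
Proof.
move=> fg af e e0; have [N [p [tp fp]]] := af e e0; exists N, p; split => //.
apply: le_lt_trans fp; rewrite le_eqVlt; apply/orP; left; apply/eqP.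
by apply: eq_Rintegral => t /set_mem bt; rewrite (fg t bt).
Qed.

Lemma trig_approx_close f : square_integrable f ->
  (forall e : R, 0 < e -> exists g, [/\ square_integrable g, trig_approx g &
     inner (fun v => f v - g v) (fun v => f v - g v) < e]) -> trig_approx f.
Proof.
move=> sf H e e0; have e4 : 0 < e / 4 by rewrite divr_gt0.
have [g [sg ag fg]] := H _ e4; have [N [p [tp gp]]] := ag _ e4.
have sp := trig_poly_square_integrable tp.
exists N, p; split => //.
have -> : (fun v => f v - p v) = (fun v => (f v - g v) + (g v - p v)).
  by apply/funext => v; ring.
apply: le_lt_trans (inner_addadd_le (square_integrableB sf sg) (square_integrableB sg sp))
  _.
by lra.
Qed.

Lemma trig_approx_cvg (F : nat -> 'rV[R]_d -> R) f g :
  (forall n, trig_approx (F n)) ->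
  (forall n, measurable_row (F n)) -> measurable_row f -> square_integrable g ->
  (forall n t, B t -> `|F n (row_of t)| <= g (row_of t)) ->
  (forall t, B t -> `|f (row_of t)| <= g (row_of t)) ->
  {ae mu, forall t, B t -> F n (row_of t) @[n --> \oo] --> f (row_of t)} ->
  trig_approx f.
Proof.
move=> aF mF mf sg Fg fg Ff; apply: trig_approx_close.
  exact: dominated_square_integrable sg.
move=> e e0; have [n fn] := L2_dominated_cvg mF mf sg Fg fg Ff e0.
by exists (F n); split => //; exact: dominated_square_integrable (mF n) (Fg n) sg.
Qed.

Lemma trig_approxD f g : square_integrable f -> square_integrable g ->
  trig_approx f -> trig_approx g -> trig_approx (fun v => f v + g v).
Proof.
move=> sf sg af ag e e0; have e4 : 0 < e / 4 by rewrite divr_gt0.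
have [N [p [tp fp]]] := af _ e4; have [M [q [tq gq]]] := ag _ e4.
have sp := trig_poly_square_integrable tp; have sq := trig_poly_square_integrable tq.
exists (N + M)%N, (fun v => p v + q v); split.
  by apply: trig_polyD; [apply: trig_poly_mono tp;
    exact: leq_addr|apply: trig_poly_mono tq; exact: leq_addl].
have -> : (fun v => f v + g v - (p v + q v)) = (fun v => (f v - p v) + (g v - q v)).
  by apply/funext => v; ring.
apply: le_lt_trans (inner_addadd_le (square_integrableB sf sp) (square_integrableB sg sq))
  _.
by lra.
Qed.

Lemma trig_approxZ (c : R) f : square_integrable f -> trig_approx f ->
  trig_approx (fun v => c * f v).
Proof.
move=> sf af e e0; have e4 : 0 < e / (c ^+ 2 + 1) by rewrite divr_gt0 // ltr_wpDl ?sqr_ge0.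
have [N [p [tp fp]]] := af _ e4; have sp := trig_poly_square_integrable tp.
exists N, (fun v => c * p v); split; first exact: trig_polyZ.
have -> : (fun v => c * f v - c * p v) = (fun v => c * (f v - p v)).
  by apply/funext => v; ring.
have sfp := square_integrableB sf sp.
rewrite innerZl ?innerZr //; last exact: square_integrableZ.
move: fp; rewrite ltr_pdivlMr ?ltr_wpDl ?sqr_ge0 // => fp.
by apply: le_lt_trans fp; have := inner_ge0 (fun v => f v - p v); nra.
Qed.

Lemma trig_approx_sum (I : eqType) (s : seq I) (c : I -> R) (F : I -> 'rV[R]_d -> R) :
  (forall i, i \in s -> square_integrable (F i)) ->
  (forall i, i \in s -> trig_approx (F i)) ->
  trig_approx (fun v => \sum_(i <- s) c i * F i v).
Proof.
elim: s => [|i s IH] sF aF.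
  apply: trig_approx_eq (trig_approx_trig (trig_poly0 R d 0)) => t _.
  by rewrite big_nil.
have sF' j (js : j \in s) := sF j (mem_behead (s := i :: s) js).
have aF' j (js : j \in s) := aF j (mem_behead (s := i :: s) js).
apply: trig_approx_eq (trig_approxD (square_integrableZ (c i) (sF i (mem_head _ _)))
   (square_integrable_sum c sF') (trig_approxZ _ (sF i (mem_head _ _))
     (aF i (mem_head _ _))) (IH sF' aF')).
by move=> t _; rewrite big_cons.
Qed.

(** The approximant [q] of [g] is chosen first, because the precision required of
    the approximant of [f] depends on a bound of [q]. *)
Lemma trig_approxM f g (K : R) : square_integrable f -> square_integrable g ->
  (forall t, B t -> `|f (row_of t)| <= K) ->
  trig_approx f -> trig_approx g -> trig_approx (fun v => f v * g v).
Proof.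
move=> sf sg fK af ag e e0; have [mf _] := sf.
have eK : 0 < e / (4 * (K ^+ 2 + 1)) by rewrite divr_gt0 // mulr_gt0 // ltr_wpDl ?sqr_ge0.
have [M [q [tq gq]]] := ag _ eK.
have sq := trig_poly_square_integrable tq; have [mq _] := sq.
have [L qL] := trig_poly_bounded tq.
have eL : 0 < e / (4 * (L ^+ 2 + 1)) by rewrite divr_gt0 // mulr_gt0 // ltr_wpDl ?sqr_ge0.
have [N [p [tp fp]]] := af _ eL; have sp := trig_poly_square_integrable tp.
exists (N + M)%N, (fun v => p v * q v); split; first exact: trig_polyM.
have -> : (fun v => f v * g v - p v * q v) =
    (fun v => f v * (g v - q v) + q v * (f v - p v)).
  by apply/funext => v; ring.
have [s1 i1] := inner_mul_bound mf fK (square_integrableB sg sq).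
have [s2 i2] := inner_mul_bound mq (fun t _ => qL (row_of t)) (square_integrableB sf sp).
apply: le_lt_trans (inner_addadd_le s1 s2) _.
move: gq fp; rewrite !ltr_pdivlMr ?mulr_gt0 ?ltr_wpDl ?sqr_ge0 // => gq fp.
have := inner_ge0 (fun v => g v - q v); have := inner_ge0 (fun v => f v - p v).
by move: i1 i2 gq fp; lra.
Qed.

End density.

(** * Density of trigonometric polynomials *)

Import HBNNSimple.
Section sets.
Context (R : realType) (d : nat).
Implicit Types (f g h p q : 'rV[R]_d -> R).
Local Notation B := (@box R d).
Local Notation mu := (lebesgue_tuple R d).
Local Notation tup := (d.-tuple (measurableTypeR R)).
Implicit Types A : set tup.

Let mB : measurable B := @measurable_box R d.

(** Measurable sets live on tuples and functions on row vectors; this map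
    carries indicators of the former over to the latter. *)
Definition tuple_of_row (v : 'rV[R]_d) : tup := [tuple v 0 i | i < d].

Lemma row_ofK : cancel (@row_of R d) tuple_of_row.
Proof. by move=> t; apply: eq_from_tnth => i; rewrite tnth_mktuple mxE. Qed.

Definition row_indic A (v : 'rV[R]_d) : R := \1_A (tuple_of_row v).

Lemma row_indicE A t : row_indic A (row_of t) = \1_A t.
Proof. by rewrite /row_indic row_ofK. Qed.

Lemma measurable_row_indic A : measurable A -> measurable_row (row_indic A).
Proof.
move=> mA; rewrite /measurable_row (_ : _ \o _ = \1_A); first exact: measurable_indic.
by apply/funext => t /=; rewrite row_indicE.
Qed.

Lemma row_indic_bound A v : `|row_indic A v| <= 1.
Proof. by rewrite /row_indic indicE; case: (_ \in _); rewrite ?normr1 ?normr0. Qed.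

Lemma square_integrable_row_indic A : measurable A -> square_integrable (row_indic A).
Proof.
move=> mA; apply: (bounded_square_integrable (M := 1)); first exact: measurable_row_indic.
by move=> t _; exact: row_indic_bound.
Qed.

Lemma step_bound q n v : `|q v| <= 2 -> `|step (q v) n| <= 1.
Proof. by move=> /(step_itv n) /andP[s0 s1]; rewrite ger0_norm. Qed.

(** The indicator of [q > 0] is almost everywhere the bounded limit of the
    polynomials [step] in [q]. *)
Lemma trig_approx_pos N q A : trig_poly N q -> (forall v, `|q v| <= 2) -> measurable A ->
  {ae mu, forall t, B t -> A t <-> 0 < q (row_of t)} -> trig_approx (row_indic A).
Proof.
move=> tq q2 mA Aq.
have tS n : exists M, trig_poly M (fun v => step (q v) n).
  have t1 : trig_poly N (fun v => step_arg (q v) n).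
    rewrite /step_arg; apply: trig_polyD;
      last by apply: trig_poly_mono (trig_poly_cst _ _); exact: leq0n.
    apply: trig_polyD; last exact: trig_polyZ.
    by apply: trig_poly_mono (trig_poly_cst _ _).
  eexists; rewrite /step; apply: trig_polyX.
  rewrite (_ : (fun v => _) = (fun v => 1 + (-1) * step_arg (q v) n ^+ (n.+1 ^ 2)));
    last first.
    by apply/funext => v; rewrite mulN1r.
  apply: trig_polyD; last by apply: trig_polyZ; apply: trig_polyX; exact: t1.
  by apply: trig_poly_mono (trig_poly_cst _ _).
apply: (trig_approx_cvg (F := fun n v => step (q v) n) (g := fun=> 1)).
- by move=> n; have [M tM] := tS n; exact: trig_approx_trig tM.
- by move=> n; have [M /trig_poly_square_integrable[]] := tS n.
- exact: measurable_row_indic.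
- exact: square_integrable_cst.
- by move=> n t _; exact: step_bound.
- by move=> t _; exact: row_indic_bound.
- move: Aq; apply: filterS => t At bt; rewrite row_indicE indicE.
  have [q0|q0] := ltP 0 (q (row_of t)).
    rewrite mem_set; last by apply/(At bt).
    exact: step_cvg1.
  rewrite memNset; first exact: step_cvg0.
  by move=> /(At bt); rewrite ltNge q0.
Qed.

Definition approx_set A := measurable A /\ trig_approx (row_indic A).

Lemma approx_set0 : approx_set set0.
Proof.
split => //; apply: trig_approx_eq (trig_approx_trig (trig_poly0 R d 0)) => t _.
by rewrite row_indicE indicE in_set0.
Qed.

Lemma approx_setC A : approx_set A -> approx_set (~` A).
Proof.
move=> [mA aA]; split; first exact: measurableC.
have sA := square_integrable_row_indic mA.
have s1 := @square_integrable_cst R d 1.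
apply: trig_approx_eq (trig_approxD s1 (square_integrableZ (-1) sA)
  (trig_approx_trig (trig_poly_cst d 1)) (trig_approxZ (-1) sA aA)) => t _.
by rewrite !row_indicE indicC indicE; case: (_ \in _); rewrite /=; ring.
Qed.

Lemma approx_setI A A' : approx_set A -> approx_set A' -> approx_set (A `&` A').
Proof.
move=> [mA aA] [mA' aA']; split; first exact: measurableI.
have sA := square_integrable_row_indic mA; have sA' := square_integrable_row_indic mA'.
apply: trig_approx_eq (trig_approxM sA sA' (fun t _ => row_indic_bound A (row_of t)) aA
  aA') => t _.
by rewrite !row_indicE indicI.
Qed.

Lemma approx_setU A A' : approx_set A -> approx_set A' -> approx_set (A `|` A').
Proof.
move=> aA aA'; rewrite -(setCK (A `|` A')) setCU.
by apply: approx_setC; apply: approx_setI; apply: approx_setC.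
Qed.

Lemma approx_set_bigcup (F : (set tup)^nat) : (forall n, approx_set (F n)) ->
  approx_set (\bigcup_n F n).
Proof.
move=> aF; have mU : measurable (\bigcup_n F n) by apply: bigcup_measurable => n _;
  case: (aF n).
have aU n : approx_set (\big[setU/set0]_(i < n) F i).
  by apply: big_ind; [exact: approx_set0|exact: approx_setU|move=> i _; exact: aF].
split => //.
apply: (trig_approx_cvg (F := fun n => row_indic (\big[setU/set0]_(i < n) F i))
  (g := fun=> 1)).
- by move=> n; case: (aU n).
- by move=> n; apply: measurable_row_indic; case: (aU n).
- exact: measurable_row_indic.
- exact: square_integrable_cst.
- by move=> n t _; exact: row_indic_bound.
- by move=> t _; exact: row_indic_bound.
- apply: aeW => t bt; rewrite row_indicE.
  have [[n _ Fn]|NF] := pselect ((\bigcup_n F n) t).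
    apply: cvg_near_cst; exists n.+1 => // m /= nm.
    rewrite row_indicE !indicE !mem_set //; first by exists n.
    by rewrite -bigcup_mkord; exists n.
  apply: cvg_near_cst; apply: nearW => m.
  rewrite row_indicE !indicE !memNset //.
  by rewrite -bigcup_mkord => -[i _ Fi]; apply: NF; exists i.
Qed.

Lemma sigma_algebra_approx_set : sigma_algebra setT approx_set.
Proof.
split; [exact: approx_set0| |exact: approx_set_bigcup].
by move=> A; rewrite setTD; exact: approx_setC.
Qed.

(** The interval from [- pi] to [a] is the arc of the circle with centre
    [(a - pi) / 2] and half-width [(a + pi) / 2]. *)
Lemma arc_cos (a x : R) : - pi < a <= pi -> - pi < x <= pi ->
  (x < a) = (cos ((a + pi) / 2) < cos (x - (a - pi) / 2)).
Proof.
move=> /andP[a1 a2] /andP[x1 x2].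
have p0 := pi_gt0 R.
set w := (a + pi) / 2; set y := x - _.
have w0 : w \in `[0, pi] by rewrite in_itv /=; apply/andP; split; rewrite /w; lra.
have -> : (x < a) = (y < w).
  by apply/idP/idP; rewrite /y /w; lra.
have [yw|yw] := ltP y w.
  apply/esym; rewrite -(cos_norm y) ltr_cos //.
    by rewrite ltr_norml yw andbT /w /y; lra.
  rewrite in_itv /= normr_ge0 /= ler_norml; apply/andP; split; rewrite /y; move: yw;
    rewrite /y /w; lra.
apply/esym/negbTE; rewrite -leNgt.
have [yp|yp] := leP y pi.
  rewrite leNgt ltr_cos -?leNgt // in_itv /= yp andbT.
  by apply: le_trans yw; rewrite /w; lra.
have -> : cos y = cos (pi *+ 2 - y) by rewrite -cosN -[LHS]cosD2pi; congr cos; ring.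
rewrite leNgt ltr_cos -?leNgt //; first by rewrite -mulr_natl /y /w; lra.
by rewrite in_itv /= -mulr_natl; apply/andP; split; move: yp; rewrite /y; lra.
Qed.

Lemma approx_halfspace (i : 'I_d) (a : R) : approx_set ((fun t => tnth t i) @^-1` `]-oo,
  a[%classic).
Proof.
have mH : measurable ((fun t : tup => tnth t i) @^-1` `]-oo, a[%classic).
  by rewrite -[X in measurable X]setTI; apply: measurable_tnth => //; exact: measurable_itv.
split => //.
have [a1|a1] := leP a (- pi).
  apply: trig_approx_eq (trig_approx_trig (trig_poly0 R d 0)) => t bt.
  rewrite row_indicE indicE memNset //= in_itv /=; apply/negP; rewrite -leNgt.
  by apply: le_trans a1 _; have /andP[] := bt i.
have [a2|a2] := leP a pi; last first.
  apply: trig_approx_eq (trig_approx_trig (trig_poly_cst d 1)) => t bt.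
  rewrite row_indicE indicE mem_set //= in_itv /=.
  by apply: le_lt_trans a2; have /andP[] := bt i.
pose m := (a - pi) / 2; pose w := (a + pi) / 2.
pose k : {ffun 'I_d -> int} := [ffun j => (j == i)%:Z].
pose q v := wave k (- m) v + (- cos w) * 1 : R.
have qE v : q v = cos (v 0 i - m) - cos w.
  rewrite /q /wave mulr1 (bigD1 i) //= ffunE eqxx mul1r big1 ?addr0 // => j /negPf ji.
  by rewrite ffunE ji mul0r.
apply: (trig_approx_pos (N := 1) (q := q)) => //.
- apply: trig_polyD; last by apply: trig_polyZ; apply: trig_poly_mono (trig_poly_cst _ _).
  by apply: trig_poly_wave => j; rewrite ffunE; case: (j == i).
- move=> v; rewrite qE; apply: le_trans (ler_normB _ _) _.
  by have := cos_max (v 0 i - m); have := cos_max w; lra.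
- exists (B `&` [set t | tnth t i = - pi]); split.
  + apply: measurableI => //; rewrite [X in measurable X](_ : _ =
    setT `&` (fun t : tup => tnth t i) @^-1` [set - pi]); last by rewrite setTI.
    exact: measurable_tnth.
  + exact: null_face.
  + move=> t /= H; apply: contrapT => /not_andP NH; apply: H => bt.
    have ti : tnth t i <> - pi by case: NH.
    rewrite in_itv /= qE mxE subr_gt0 -arc_cos ?a1 ?a2 //.
    have /andP[t1 ->] := bt i; rewrite andbT lt_neqAle t1 andbT.
    by apply/eqP => /esym.
Qed.

Lemma approx_measurable A : measurable A -> approx_set A.
Proof.
apply: (smallest_sub sigma_algebra_approx_set).
rewrite -bigcup_seq /= => A' [i _] [X mX <-]; rewrite setTI.
have sX : sigma_algebra setT [set X : set (measurableTypeR R) | approx_set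
  ((fun t => tnth t i) @^-1` X)].
  split => /=.
  - by rewrite preimage_set0; exact: approx_set0.
  - by move=> Y; rewrite setTD preimage_setC; exact: approx_setC.
  - by move=> Y HY; rewrite preimage_bigcup; exact: approx_set_bigcup.
have := RGenInftyO.measurableE R; rewrite /measurable /= => E.
have : (RGenInftyO.G (R:=R)).-sigma.-measurable X by rewrite -RGenInftyO.measurableE.
move: X {mX E}; apply: (smallest_sub sX) => X [x ->] /=.
exact: approx_halfspace.
Qed.

Lemma trig_approx_nnsfun (s : {nnsfun tup >-> R}) :
  trig_approx (fun v => s (tuple_of_row v)).
Proof.
pose e := finmap.enum_fset (fset_set (range s)).
apply: trig_approx_eq (trig_approx_sum (s := index_enum 'I_(size e)) (fun i => e`_i)
  (F := fun i => row_indic (s @^-1` [set e`_i])) _ _).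
- by move=> t _; rewrite row_ofK fimfunEord; apply: eq_bigr => i _; rewrite row_indicE.
- by move=> i _; apply: square_integrable_row_indic; exact: measurable_sfunP.
- by move=> i _; case: (@approx_measurable (s @^-1` [set e`_i])) => //;
  exact: measurable_sfunP.
Qed.

Lemma trig_approx_ge0 f : square_integrable f -> (forall v, 0 <= f v) -> trig_approx f.
Proof.
move=> sf f0; have [mf _] := sf.
pose F : tup -> \bar R := EFin \o (f \o @row_of R d).
have mF : measurable_fun [set: tup] F by apply/measurable_EFinP.
pose s := nnsfun_approx measurableT mF.
have sF t : s n t @[n --> \oo] --> f (row_of t).
  have F0 (x : tup) : [set: tup] x -> (0 <= F x)%E by move=> _; rewrite lee_fin f0.
  have /fine_cvgP[_] := cvg_nnsfun_approx measurableT mF F0 (I : [set: tup] t).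
  exact.
have sle n t : s n t <= f (row_of t).
  rewrite -(cvg_lim (@Rhausdorff R) (sF t)); apply: nondecreasing_cvgn_le.
    by move=> a b ab; exact/lefP/nd_nnsfun_approx.
  by apply/cvg_ex; exists (f (row_of t)); exact: sF.
apply: (trig_approx_cvg (F := fun n v => s n (tuple_of_row v)) (g := f)) => //.
- by move=> n; exact: trig_approx_nnsfun.
- move=> n; rewrite /measurable_row (_ : _ \o _ = s n); first exact: measurable_funP.
  by apply/funext => t /=; rewrite row_ofK.
- by move=> n t _; rewrite row_ofK ger0_norm.
- by move=> t _; rewrite ger0_norm.
- by apply: aeW => t _; under eq_fun do rewrite row_ofK; exact: sF.
Qed.

Theorem trig_poly_dense f : square_integrable f -> trig_approx f.
Proof.
move=> sf; have [mf _] := sf.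
have pos g : square_integrable g -> square_integrable (fun v => Num.max (g v) 0).
  move=> [mg Ig]; split; first by apply: measurable_maxr => //; exact: measurable_cst.
  apply: (le_integrable mB _ _ Ig).
    by apply/measurable_EFinP; apply: measurable_funTS; apply: measurable_funX;
      apply: measurable_maxr => //; exact: measurable_cst.
  move=> t _ /=; rewrite lee_fin !normrX ler_sqr ?nnegrE //.
  by case: (leP (g (row_of t)) 0) => _; rewrite ?normr0.

have sN := square_integrableZ (-1) sf.
have p0 (g : 'rV[R]_d -> R) v : 0 <= Num.max (g v) 0 by rewrite le_max lexx orbT.
apply: trig_approx_eq (trig_approxD (pos _ sf) (square_integrableZ (-1) (pos _ sN))
  (trig_approx_ge0 (pos _ sf) (p0 f)) (trig_approxZ (-1) (pos _ sN)
    (trig_approx_ge0 (pos _ sN) (p0 _)))) => t _.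
by case: (leP (f (row_of t)) 0); case: (leP (-1 * f (row_of t)) 0); lra.
Qed.

End sets.

(** * Fourier sums and their rate of convergence *)

Section fourier.
Context (R : realType) (d : nat).
Implicit Types (f g h p q : 'rV[R]_d -> R) (k l : {ffun 'I_d -> int})
  (s : seq {ffun 'I_d -> int}).
Local Notation coefc f k := (inner f (wave k 0)).
Local Notation coefs f k := (inner f (wave k (- (pi / 2)))).
Local Notation vol := ((2 * pi) ^+ d : R).
Hint Resolve square_integrable_wave : core.

Lemma vol_gt0 : 0 < vol.
Proof. by rewrite exprn_gt0 // mulr_gt0 ?pi_gt0. Qed.

Lemma inner_wave_phase f k a : square_integrable f ->
  inner f (wave k a) = cos a * coefc f k - sin a * coefs f k.
Proof.
move=> sf; rewrite (_ : wave k a = (fun v => cos a * wave k 0 v + (- sin a) * wave k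
  (- (pi / 2)) v)); last first.
  by apply/funext => v; exact: waveE.
rewrite innerDr ?innerZr // ?mulNr //; exact: square_integrableZ.
Qed.

(** The squared modulus of the integral of [f] against the exponential of
    frequency [k]. *)
Definition energy_at f k : R := coefc f k ^+ 2 + coefs f k ^+ 2.

(** A change of phase rotates the pair of the cosine and sine coefficients. *)
Lemma energy_at_phase f k a : square_integrable f ->
  inner f (wave k a) ^+ 2 + inner f (wave k (a - pi / 2)) ^+ 2 = energy_at f k.
Proof.
move=> sf; rewrite (inner_wave_phase k a sf) (inner_wave_phase k (a - pi / 2) sf)
  cosBpihalf sinBpihalf /energy_at.
move: (coefc f k) (coefs f k) => x y; have := cos2Dsin2 a; move: (cos a) (sin a) => c t E.
transitivity ((c ^+ 2 + t ^+ 2) * (x ^+ 2 + y ^+ 2)); first by ring.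
by rewrite E mul1r.
Qed.

Lemma energy_at_ge0 f k : 0 <= energy_at f k.
Proof. by rewrite addr_ge0 ?sqr_ge0. Qed.

Lemma coefcN f k : coefc f (- k) = coefc f k.
Proof. by congr inner; apply/funext => v; rewrite waveN oppr0. Qed.

Lemma coefsN f k : square_integrable f -> coefs f (- k) = - coefs f k.
Proof.
move=> sf; rewrite (_ : wave (- k) _ = wave k (pi / 2)); last first.
  by apply/funext => v; rewrite waveN opprK.
by rewrite (inner_wave_phase k (pi / 2) sf) cos_pihalf sin_pihalf mul0r mul1r sub0r.
Qed.

Definition energy s f : R := vol^-1 * \sum_(k <- s) energy_at f k.

(** The frequencies [k] and [- k] both contribute, although they carry the same
    waves: hence the factor [1 / (2 pi)^d] in place of twice that number, and the
    symmetry of [s] required below. *)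
Definition fourier_sum s f (v : 'rV[R]_d) : R :=
  \sum_(k <- s) (vol^-1 * coefc f k) * wave k 0 v +
  \sum_(k <- s) (vol^-1 * coefs f k) * wave k (- (pi / 2)) v.

Lemma square_integrable_fourier_sum s f : square_integrable (fourier_sum s f).
Proof. by apply: square_integrableD; apply: square_integrable_sum. Qed.
Hint Resolve square_integrable_fourier_sum : core.

Lemma inner_fourier_sum s f h : square_integrable h ->
  inner (fourier_sum s f) h =
  vol^-1 * \sum_(k <- s) (coefc f k * coefc h k + coefs f k * coefs h k).
Proof.
move=> sh; rewrite innerDl //; try exact: square_integrable_sum.
rewrite !inner_suml // -big_split mulr_sumr; apply: eq_bigr => k _ /=.
by rewrite !(innerC _ h); ring.
Qed.

Lemma sum_pred1_seq s l (G : {ffun 'I_d -> int} -> R) : uniq s -> l \in s ->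
  \sum_(k <- s) (k == l)%:R * G k = G l.
Proof.
move=> us ls; rewrite (bigD1_seq l) //= eqxx mul1r big1 ?addr0 // => k /negPf ->.
by rewrite mul0r.
Qed.

(** The wave at [l] meets those at [l] and at [- l], each for half of the
    coefficient; the two halves agree because cosine coefficients are even and
    sine coefficients odd in the frequency. *)
Lemma inner_fourier_sum_wave s f l a : uniq s -> (forall k, (- k \in s) = (k \in s)) ->
  square_integrable f -> l \in s ->
  inner (fourier_sum s f) (wave l a) = inner f (wave l a).
Proof.
move=> us symm sf ls; have k0 := lt0r_neq0 vol_gt0.
have lNs : - l \in s by rewrite symm.
rewrite inner_fourier_sum // (inner_wave_phase l a sf).
transitivity (2^-1 * (\sum_(k <- s) (k == - l)%:R *
  (coefc f k * cos a + coefs f k * sin a)) +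
   2^-1 * (\sum_(k <- s) (k == l)%:R * (coefc f k * cos a - coefs f k * sin a))).
  rewrite !mulr_sumr -big_split; apply: eq_bigr => k _ /=.
  rewrite !(innerC (wave l a)) !inner_wave add0r sub0r cosN.
  have -> : cos (- (pi / 2) + a) = sin a by rewrite addrC cosBpihalf.
  have -> : cos (- (pi / 2) - a) = - sin a by rewrite -opprD cosN addrC cosDpihalf.
  by field; exact: k0.
by rewrite !sum_pred1_seq // coefcN coefsN //; field.
Qed.

Lemma inner_fourier_sum_self s f : uniq s -> (forall k, (- k \in s) = (k \in s)) ->
  square_integrable f -> inner (fourier_sum s f) (fourier_sum s f) = energy s f.
Proof.
move=> us symm sf; rewrite inner_fourier_sum // /energy; congr (_ * _).
rewrite !big_seq; apply: eq_bigr => k ks.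
by rewrite !(inner_fourier_sum_wave _ us symm sf ks) -!expr2.
Qed.

Lemma inner_fourier_sum_energy s f : square_integrable f ->
  inner (fourier_sum s f) f = energy s f.
Proof.
by move=> sf; rewrite inner_fourier_sum.
Qed.

Lemma fourier_error s f : uniq s -> (forall k, (- k \in s) = (k \in s)) ->
  square_integrable f ->
  inner (fun v => f v - fourier_sum s f v) (fun v => f v - fourier_sum s f v) =
  inner f f - energy s f.
Proof.
move=> us symm sf; rewrite inner_subsub // inner_fourier_sum_self //.
by rewrite innerC inner_fourier_sum_energy //; ring.
Qed.

Lemma Bessel s f : uniq s -> (forall k, (- k \in s) = (k \in s)) ->
  square_integrable f -> energy s f <= inner f f.
Proof. by move=> us symm sf; rewrite -subr_ge0 -fourier_error // inner_ge0. Qed.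

Lemma trig_poly_fourier_sum N f : trig_poly N (fourier_sum (freqs d N) f).
Proof.
by apply: trig_polyD; apply: trig_poly_sum => k; rewrite mem_freqs => /forallP kN;
  exact: trig_poly_wave.
Qed.

Lemma fourier_error_orth N f p : square_integrable f -> trig_poly N p ->
  inner (fun v => f v - fourier_sum (freqs d N) f v) p = 0.
Proof.
move=> sf /trig_polyE[c ->].
have se := square_integrableB sf (square_integrable_fourier_sum (freqs d N) f).
rewrite inner_sumr // ?big1 // => [x _|x _]; last exact: square_integrable_wave.
rewrite innerBl //; last exact: square_integrable_wave.
rewrite inner_fourier_sum_wave ?subrr ?mulr0 //; first exact: freqs_uniq.
  by move=> k; rewrite freqs_opp.
exact: codom_f.
Qed.

(** Pythagoras: the error of the Fourier sum is orthogonal to its difference from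
    [p]. *)
Lemma fourier_best N f p : square_integrable f -> trig_poly N p ->
  inner f f - energy (freqs d N) f <= inner (fun v => f v - p v) (fun v => f v - p v).
Proof.
move=> sf tp; have sp := trig_poly_square_integrable tp.
have symm k : (- k \in freqs d N) = (k \in freqs d N) by rewrite freqs_opp.
rewrite -(fourier_error (freqs_uniq d N) symm sf).
set P := fourier_sum _ f.
have sP : square_integrable P := square_integrable_fourier_sum _ f.
have -> : (fun v => f v - p v) = (fun v => (f v - P v) + (P v - p v)).
  by apply/funext => v; ring.
have tPp : trig_poly N (fun v => P v - p v).
  have := trig_polyD (trig_poly_fourier_sum N f) (trig_polyZ (-1) tp).
  by congr trig_poly; apply/funext => v; rewrite mulN1r.
have orth : inner (fun v => f v - P v) (fun v => P v - p v) = 0.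
  exact: fourier_error_orth sf tPp.
rewrite (inner_addadd (square_integrableB sf sP) (square_integrableB sP sp)).
by rewrite orth mulr0 addr0 lerDl inner_ge0.
Qed.

Definition single_order (j : 'I_d) (r : nat) : 'I_d -> nat :=
  fun i => if i == j then r else 0%N.

Lemma multi_order_single j r : multi_order (single_order j r) = r.
Proof.
rewrite /multi_order (bigD1 j) //= /single_order eqxx big1 ?addn0 // => i /negPf -> //.
Qed.

Lemma multi_partial_wave (a : 'I_d -> nat) k (b : R) : multi_partial a (wave k b) =
  (fun v => (\prod_i (k i)%:~R ^+ a i) * wave k (b + (multi_order a)%:R * (pi / 2)) v).
Proof.
rewrite /multi_partial partials_wave; apply/funext => v.
congr (_ * _); last congr (wave _ (_ + _%:R * _) _).
  rewrite big_flatten /= big_map big_enum /=; apply: eq_bigr => i _.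
  by rewrite big_nseq -Monoid.iteropE.
rewrite size_flatten /shape -map_comp sumnE big_map big_enum /=.
by apply: eq_bigr => i _; rewrite size_nseq.
Qed.

(** Testing the weak derivative against waves replaces the coefficient of [g] by
    that of [f] times [k_j^r], up to a sign and a rotation of the phase. *)
Lemma weak_derivative_energy f g j r k : square_integrable f -> square_integrable g ->
  weak_derivative (single_order j r) f g ->
  energy_at g k = (k j)%:~R ^+ r ^+ 2 * energy_at f k.
Proof.
move=> sf sg fg.
have H b : inner g (wave k b) ^+ 2 = (k j)%:~R ^+ r ^+ 2 * inner f
  (wave k (b + r%:R * (pi / 2))) ^+ 2.
  have := fg _ (smooth_wave k b) (periodic_wave k b).
  rewrite multi_partial_wave multi_order_single innerZr //.
  have -> : \prod_i (k i)%:~R ^+ single_order j r i = (k j)%:~R ^+ r :> R.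
    rewrite (bigD1 j) //= /single_order eqxx big1 ?mulr1 // => i /negPf -> //.
  by move=> /(congr1 (fun x => x ^+ 2)); rewrite !exprMn sqrr_sign mul1r => <-.
rewrite -(energy_at_phase k (r%:R * (pi / 2)) sf) mulrDr /energy_at !H add0r.
by rewrite (addrC (- _)).
Qed.

Lemma sum_freqs_sub N M (G : {ffun 'I_d -> int} -> R) : (N <= M)%N ->
  \sum_(k <- freqs d M) G k =
  \sum_(k <- freqs d N) G k + \sum_(k <- freqs d M | k \notin freqs d N) G k.
Proof.
move=> NM; rewrite (bigID (fun k => k \in freqs d N)) /=; congr (_ + _).
rewrite -big_filter; apply: perm_big; apply: uniq_perm.
- exact/filter_uniq/freqs_uniq.
- exact: freqs_uniq.
- move=> k; rewrite mem_filter andb_idr // !mem_freqs => /forallP kN.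
  by apply/forallP => i; exact: leq_trans NM.
Qed.

(** Density reduces the error to the energy between the cube of size [N] and a
    larger cube of size [M], and there each frequency has a component beyond
    [N]. *)
Lemma fourier_rate N r f (g : 'I_d -> 'rV[R]_d -> R) : (1 <= N)%N ->
  square_integrable f -> (forall j, square_integrable (g j)) ->
  (forall j, weak_derivative (single_order j r) f (g j)) ->
  inner f f - energy (freqs d N) f <= N%:R ^- r ^+ 2 * \sum_j inner (g j) (g j).
Proof.
move=> N1 sf sg fg; apply/ler_addgt0Pr => e e0.
have [M0 [p [tp fp]]] := trig_poly_dense sf e0.
pose M := maxn N M0.
have NM : (N <= M)%N by rewrite leq_maxl.
have fM : inner f f - energy (freqs d M) f < e.
  apply: le_lt_trans (fourier_best sf _) fp; apply: trig_poly_mono tp.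
  exact: leq_maxr.
suff H : energy (freqs d M) f - energy (freqs d N) f <=
  N%:R ^- r ^+ 2 * \sum_j inner (g j) (g j) by lra.
have N0 : 0 < N%:R :> R by rewrite ltr0n.
rewrite /energy (sum_freqs_sub _ NM) mulrDr addrAC subrr add0r.
have symm k : (- k \in freqs d M) = (k \in freqs d M) by rewrite freqs_opp.
apply: (@le_trans _ _ (N%:R ^- r ^+ 2 * \sum_j energy (freqs d M) (g j))); last first.
  rewrite ler_wpM2l ?sqr_ge0 //; apply: ler_sum => j _.
  exact: Bessel (freqs_uniq d M) symm (sg j).
rewrite /energy -mulr_sumr mulrCA ler_wpM2l ?invr_ge0 ?(ltW vol_gt0) //.
rewrite exchange_big /= mulr_sumr big_mkcond /=; apply: ler_sum => k _.
have S0 : 0 <= N%:R ^- r ^+ 2 * \sum_j energy_at (g j) k.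
  by rewrite mulr_ge0 ?sqr_ge0 // sumr_ge0 // => j _; exact: energy_at_ge0.
case: ifPn => //; rewrite mem_freqs => /forallPn[j]; rewrite -ltnNge => kj.
rewrite (bigD1 j) //= mulrDr; apply: ler_wpDr.
  by rewrite mulr_ge0 ?sqr_ge0 // sumr_ge0 // => i _; exact: energy_at_ge0.
rewrite (weak_derivative_energy _ sf (sg j) (fg j)) mulrA ler_peMl ?energy_at_ge0 //.
rewrite -exprMn -exprVn -exprMn -exprM mulnC exprM exprn_ege1 //.
rewrite exprMn -[X in _ * X]real_normK ?num_real // -exprMn exprn_ege1 //.
rewrite mulrC ler_pdivlMr // mul1r -intr_norm -pmulrn.
by rewrite ler_nat ltnW.
Qed.

End fourier.

(** * Functions dual to the collision invariants *)

Section dual.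
Context (R : realType) (d : nat).
Implicit Types (f g h p q : 'rV[R]_d -> R) (i j : 'I_d).
Local Notation vol := ((2 * pi) ^+ d : R).
Hint Resolve square_integrable_wave : core.

Lemma integral_itv_cst1 : \int[lebesgue_measure]_(x in `[- pi, pi]) (1 : R) = 2 * pi.
Proof.
rewrite Rintegral_cst; last exact: measurable_itv.
by rewrite [X in fine X](lebesgue_itv_pi R) mul1r.
Qed.

(** Multiplied by the length of the period, so that the truncated exponent [d - 1]
    does not appear. *)
Lemma integral_coord i (phi : R -> R) : continuous phi ->
  2 * pi * box_integral (fun v : 'rV[R]_d => phi (v 0 i)) =
  vol * \int[lebesgue_measure]_(x in `[- pi, pi]) phi x.
Proof.
move=> cphi; pose g j : R -> R := if j == i then phi else cst 1.
have cg j : continuous (g j) by rewrite /g; case: (j == i) => // x; exact: cvg_cst.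
have := integral_box_prod_continuous cg.
rewrite [X in _ = X](bigD1 i) //= {2}/g eqxx => H.
have -> : box_integral (fun v : 'rV[R]_d => phi (v 0 i)) =
  (\int[lebesgue_tuple R d]_(t in @box R d) \prod_j g j (tnth t j))%R.
  apply: eq_Rintegral => t _; rewrite mxE (bigD1 i) //= big1 ?mulr1 /g ?eqxx //.
  by move=> j /negPf ->.
rewrite H mulrCA [RHS]mulrC; congr (_ * _).
rewrite -[in RHS](card_ord d) -prodr_const [RHS](bigD1 i) //=; congr (_ * _).
apply: eq_bigr => j /negPf ji; rewrite /g ji; exact: integral_itv_cst1.
Qed.

Lemma integral_coord2 i j (phi chi : R -> R) : i != j ->
  continuous phi -> continuous chi ->
  \int[lebesgue_measure]_(x in `[- pi, pi]) phi x = 0 ->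
  box_integral (fun v : 'rV[R]_d => phi (v 0 i) * chi (v 0 j)) = 0.
Proof.
move=> ij cphi cchi phi0.
pose g k : R -> R := if k == i then phi else if k == j then chi else cst 1.
have cg k : continuous (g k).
  by rewrite /g; case: (k == i) => //; case: (k == j) => // x; exact: cvg_cst.
have := integral_box_prod_continuous cg.
rewrite [X in _ = X](bigD1 i) //= {2}/g eqxx phi0 mul0r => <-.
apply: eq_Rintegral => t _; rewrite !mxE (bigD1 i) //= (bigD1 j) 1?eq_sym //= big1 ?mulr1
  /g ?eqxx.
  by rewrite eq_sym (negPf ij).
by move=> k /andP[/negPf -> /negPf ->].
Qed.

Definition unit_freq i : {ffun 'I_d -> int} := [ffun j => (j == i)%:Z].

Lemma unit_waveE i a (v : 'rV[R]_d) : wave (unit_freq i) a v = cos (v 0 i + a).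
Proof.
rewrite /wave (bigD1 i) //= ffunE eqxx mul1r big1 ?addr0 // => j /negPf ji.
by rewrite ffunE ji mul0r.
Qed.

Lemma trig_poly_unit_wave N i a : (1 <= N)%N -> trig_poly N (wave (R := R) (unit_freq i) a).
Proof.
by move=> N1; apply: trig_poly_wave => j; rewrite ffunE; case: (j == i).
Qed.

Definition coord_pow (j : 'I_d) n (v : 'rV[R]_d) : R := v 0 j ^+ n.

Lemma square_integrable_coord_pow j n : square_integrable (coord_pow j n).
Proof.
apply: (bounded_square_integrable (M := pi ^+ n)).
  rewrite /measurable_row /coord_pow; apply: measurable_funX => /=.
  by under eq_fun do rewrite mxE; exact: measurable_tnth.
move=> t bt; rewrite /coord_pow mxE normrX lerXn2r ?nnegrE ?pi_ge0 //.
by rewrite ler_norml bt.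
Qed.
Hint Resolve square_integrable_coord_pow : core.

Definition sum_sq (v : 'rV[R]_d) : R := \sum_j v 0 j ^+ 2.

Lemma sum_sqE : sum_sq = (fun v => \sum_j 1 * coord_pow j 2 v).
Proof. by apply/funext => v; apply: eq_bigr => j _; rewrite mul1r. Qed.

Lemma square_integrable_sum_sq : square_integrable sum_sq.
Proof. by rewrite sum_sqE; apply: square_integrable_sum. Qed.
Hint Resolve square_integrable_sum_sq : core.

Lemma inner_unit_wave i j a n : inner (wave (unit_freq i) a) (coord_pow j n) =
  box_integral (fun v : 'rV[R]_d => cos (v 0 i + a) * v 0 j ^+ n).
Proof. by apply: eq_Rintegral => t _; rewrite unit_waveE. Qed.

Let cos_shift_continuous a : continuous (fun x : R => cos (x + a)).
Proof.
move=> x; apply: (continuous_comp (f := +%R^~ a) (g := cos)); last exact: continuous_cos.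
by apply: cvgD; [exact: cvg_id|exact: cvg_cst].
Qed.

Let int_cos_shift a : \int[lebesgue_measure]_(x in `[- pi, pi]) cos (x + a) = 0 :> R.
Proof.
have := @integral_cos_freq R 1 a (oner_neq0 R).
rewrite mul1r sinpi => /(_ erefl) H; rewrite -[RHS]H.
by apply: eq_Rintegral => x _; rewrite mul1r.
Qed.

Lemma inner_unit_wave_offdiag i j a n : i != j ->
  inner (wave (unit_freq i) a) (coord_pow j n) = 0.
Proof.
move=> ij; rewrite inner_unit_wave.
apply: (integral_coord2 (phi := fun x => cos (x + a)) (chi := fun x => x ^+ n)) => //.
exact: exprn_continuous.
Qed.

Lemma inner_unit_wave_diag i a n (c : R) :
  \int[lebesgue_measure]_(x in `[- pi, pi]) (cos (x + a) * x ^+ n) = c * (2 * pi) ->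
  inner (wave (unit_freq i) a) (coord_pow i n) = vol * c.
Proof.
move=> H; rewrite inner_unit_wave.
have p2 : 2 * pi != 0 :> R by rewrite mulf_neq0 // lt0r_neq0 // pi_gt0.
apply: (mulfI p2); rewrite (integral_coord i (phi := fun x => cos (x + a) * x ^+ n)).
  by rewrite H; ring.
by move=> x; apply: cvgM; [exact: cos_shift_continuous|exact: exprn_continuous].
Qed.

Lemma inner_sin_coord i j : inner (wave (unit_freq i) (- (pi / 2))) (coord_pow j 1) =
  (i == j)%:R * vol.
Proof.
have [<-|ij] := eqVneq i j; last by rewrite inner_unit_wave_offdiag // mul0r.
rewrite (@inner_unit_wave_diag _ _ _ 1) ?mulr1 ?mul1r //.
rewrite -integral_x_sin; apply: eq_Rintegral => x _.
by rewrite cosBpihalf expr1.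
Qed.

Lemma inner_cos_coord i j : inner (wave (unit_freq i) 0) (coord_pow j 1) = 0.
Proof.
have [<-|ij] := eqVneq i j; last by rewrite inner_unit_wave_offdiag.
rewrite (@inner_unit_wave_diag _ _ _ 0) ?mulr0 //.
rewrite mul0r -[RHS](integral_x_cos R); apply: eq_Rintegral => x _.
by rewrite addr0 expr1.
Qed.

Lemma inner_sin_sq i j : inner (wave (unit_freq i) (- (pi / 2))) (coord_pow j 2) = 0.
Proof.
have [<-|ij] := eqVneq i j; last by rewrite inner_unit_wave_offdiag.
rewrite (@inner_unit_wave_diag _ _ _ 0) ?mulr0 //.
rewrite mul0r -[RHS](integral_x2_sin R); apply: eq_Rintegral => x _.
by rewrite cosBpihalf.
Qed.

Lemma inner_cos_sq i j : inner (wave (unit_freq i) 0) (coord_pow j 2) =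
  (i == j)%:R * (- 2 * vol).
Proof.
have [<-|ij] := eqVneq i j; last by rewrite inner_unit_wave_offdiag // mul0r.
rewrite (@inner_unit_wave_diag _ _ _ (- 2)); first by rewrite mul1r mulrC.
rewrite (_ : - 2 * (2 * pi) = - (4 * pi)); last by ring.
rewrite -(integral_x2_cos R); apply: eq_Rintegral => x _.
by rewrite addr0.
Qed.

Lemma inner_unit_wave_sum_sq i a : inner (wave (unit_freq i) a) sum_sq =
  \sum_j inner (wave (unit_freq i) a) (coord_pow j 2).
Proof. by rewrite sum_sqE inner_sumr //; apply: eq_bigr => j _; rewrite mul1r. Qed.

Lemma inner_unit_wave1 i (a : R) : inner (wave (unit_freq i) a) (fun=> 1) = 0.
Proof.
rewrite (_ : (fun=> 1) = coord_pow i 0) //.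
rewrite (@inner_unit_wave_diag _ _ _ 0) ?mulr0 //.
rewrite mul0r -[RHS](int_cos_shift a); apply: eq_Rintegral => x _.
by rewrite expr0 mulr1.
Qed.

Lemma inner11 : inner (fun _ : 'rV[R]_d => 1) (fun=> 1) = vol.
Proof.
rewrite /inner /box_integral (@eq_Rintegral _ _ _ _ _ (cst 1)); last by move=> t _;
  rewrite mulr1.
rewrite Rintegral_cst; last exact: measurable_box.
by rewrite [X in fine X](lebesgue_tuple_box R d) mul1r.
Qed.

Lemma inner1_coord j : inner (fun=> 1) (coord_pow j 1) = 0.
Proof.
have p2 : 2 * pi != 0 :> R by rewrite mulf_neq0 // lt0r_neq0 // pi_gt0.
apply: (mulfI p2); rewrite mulr0 (_ : inner _ _ =
  box_integral (fun v : 'rV[R]_d => id (v 0 j))).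
  by rewrite (integral_coord j (phi := id)) ?integral_id ?mulr0 // => x; exact: cvg_id.
by apply: eq_Rintegral => t _; rewrite mul1r /coord_pow expr1.
Qed.

Lemma Phi_comp1 (i : 'I_1) : @Phi_comp R d (lshift (d + 1) i) = (fun=> 1).
Proof. by apply/funext => v; rewrite /Phi_comp /Phi col_mxEu mxE. Qed.

Lemma Phi_comp_coord i : @Phi_comp R d (rshift 1 (lshift 1 i)) = coord_pow i 1.
Proof. by apply/funext => v; rewrite /Phi_comp /Phi col_mxEd col_mxEu mxE. Qed.

Lemma Phi_comp_sq (i : 'I_1) : @Phi_comp R d (rshift 1 (rshift d i)) = sum_sq.
Proof. by apply/funext => v; rewrite /Phi_comp /Phi !col_mxEd mxE. Qed.

Lemma square_integrable_Phi (m : 'I_(1 + (d + 1))) : square_integrable (@Phi_comp R d m).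
Proof.
case: (split_ordP m) => [i ->|m' ->]; first by rewrite Phi_comp1;
  exact: square_integrable_cst.
by case: (split_ordP m') => [i ->|i ->]; rewrite ?Phi_comp_coord ?Phi_comp_sq.
Qed.

(** The matrix of the moments of [1], [sin v_i] and [cos v_1] is triangular: the
    sines see only [v_i], by parity; [cos v_1] sees only [|v|^2], where the mean
    value of [cos v_1 * v_1^2] is [-2]; and [1] sees, besides itself, only [|v|^2],
    which a multiple of [cos v_1] removes. *)
Lemma dual_functions : (1 <= d)%N ->
  exists psi : 'I_(1 + (d + 1)) -> 'rV[R]_d -> R,
    (forall N m, (1 <= N)%N -> trig_poly N (psi m)) /\
    (forall m n, inner (psi m) (Phi_comp n) = (m == n)%:R).
Proof.
move=> d1; pose i0 : 'I_d := Ordinal d1.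
have k0 : vol != 0 by apply: lt0r_neq0; exact: vol_gt0.
pose C := wave (R := R) (unit_freq i0) 0.
pose A : R := inner (fun=> 1) sum_sq.
pose psiQ v := (- (2 * vol)^-1) * C v.
pose psi1 v := vol^-1 * 1 + (- (vol^-1 * A)) * psiQ v : R.
pose psiX i v := vol^-1 * wave (unit_freq i) (- (pi / 2)) v.
pose psi (m : 'I_(1 + (d + 1))) : 'rV[R]_d -> R :=
  match fintype.split m with
  | inl _ => psi1
  | inr m' => match fintype.split m' with inl i => psiX i | inr _ => psiQ end
  end.
have s1 := @square_integrable_cst R d 1.
have sC : square_integrable C by exact: square_integrable_wave.
have sQ : square_integrable psiQ by exact: square_integrableZ.
have EQ h : square_integrable h -> inner psiQ h = (- (2 * vol)^-1) * inner C h.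
  by move=> sh; exact: innerZl.
have E1 h : square_integrable h -> inner psi1 h =
  vol^-1 * inner (fun=> 1) h - vol^-1 * A * inner psiQ h.
  move=> sh; rewrite (innerDl (square_integrableZ _ s1) (square_integrableZ _ sQ) sh).
  by rewrite (innerZl _ s1 sh) (innerZl _ sQ sh) mulNr.
have EX i h : square_integrable h -> inner (psiX i) h =
  vol^-1 * inner (wave (unit_freq i) (- (pi / 2))) h.
  by move=> sh; exact: innerZl.
have CQ : inner C sum_sq = - 2 * vol.
  rewrite inner_unit_wave_sum_sq (bigD1 i0) //= inner_cos_sq eqxx mul1r big1 ?addr0 //.
  by move=> j ji; rewrite inner_cos_sq eq_sym (negPf ji) mul0r.
have Q1 : inner psiQ (fun=> 1) = 0 by rewrite EQ // inner_unit_wave1 mulr0.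
have QX j : inner psiQ (coord_pow j 1) = 0 by rewrite EQ // inner_cos_coord mulr0.
have QQ : inner psiQ sum_sq = 1 by rewrite EQ // CQ; field; exact: k0.
have tQ N : (1 <= N)%N -> trig_poly N psiQ.
  by move=> N1; apply: trig_polyZ; exact: trig_poly_unit_wave.
exists psi; split.
  move=> N m N1; rewrite /psi; case: fintype.split => [_|m'].
    apply: trig_polyD; last by apply: trig_polyZ; exact: tQ.
    by apply: trig_polyZ; apply: trig_poly_mono (trig_poly_cst _ _).
  case: fintype.split => [i|_]; last exact: tQ.
  by apply: trig_polyZ; exact: trig_poly_unit_wave.
move=> m n.
rewrite /psi; case: (split_ordP m) => [a ->|m' ->].
  case: (split_ordP n) => [b ->|n' ->].
    by rewrite Phi_comp1 E1 // inner11 Q1 mulr0 subr0 mulVf // (ord1 a) (ord1 b) eqxx.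
  rewrite eq_lrshift; case: (split_ordP n') => [b ->|b ->].
    by rewrite Phi_comp_coord E1 // inner1_coord QX !mulr0 subr0.
  by rewrite Phi_comp_sq E1 // QQ -/A mulr1 subrr.
case: (split_ordP m') => [a ->|a ->].
  case: (split_ordP n) => [b ->|n' ->].
    by rewrite Phi_comp1 EX // inner_unit_wave1 mulr0 eq_rlshift.
  rewrite eq_rshift; case: (split_ordP n') => [b ->|b ->].
    by rewrite Phi_comp_coord EX // inner_sin_coord eq_lshift mulrCA mulVf // mulr1.
  rewrite Phi_comp_sq EX // inner_unit_wave_sum_sq big1 ?mulr0 ?eq_lrshift //.
  by move=> j _; exact: inner_sin_sq.
case: (split_ordP n) => [b ->|n' ->]; first by rewrite Phi_comp1 Q1 eq_rlshift.
rewrite eq_rshift; case: (split_ordP n') => [b ->|b ->].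
  by rewrite Phi_comp_coord QX eq_rlshift.
by rewrite Phi_comp_sq QQ (ord1 a) (ord1 b) eqxx.
Qed.

End dual.

(** * The conservative projection *)

Section final.
Context (R : realType) (d : nat).
Implicit Types (f g h p q : 'rV[R]_d -> R).
Local Notation I := ('I_(1 + (d + 1))).

Lemma L2norm_subC f g : L2norm (fun v => f v - g v) = L2norm (fun v => g v - f v).
Proof.
by congr Num.sqrt; apply: eq_Rintegral => t _; rewrite -(opprB (g _)) mulrNN.
Qed.

Lemma L2norm_sum_le (J : eqType) (s : seq J) (c : J -> R) (F : J -> 'rV[R]_d -> R) :
  (forall j, square_integrable (F j)) ->
  L2norm (fun v => \sum_(j <- s) c j * F j v) <= \sum_(j <- s) `|c j| * L2norm (F j).
Proof.
move=> sF; elim: s => [|j s IH].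
  rewrite big_nil (_ : (fun v => _) = (fun=> 0)) /L2norm ?inner0l ?sqrtr0 //.
  by apply/funext => v; rewrite big_nil.
rewrite big_cons (_ : (fun v => _) = (fun v => c j * F j v + \sum_(j <- s) c j * F j v));
  last first.
  by apply/funext => v; rewrite big_cons.
have scF := square_integrableZ (c j) (sF j).
apply: le_trans (L2norm_triangle scF (square_integrable_sum c (fun j _ => sF j))) _.
by rewrite L2normZ // lerD2l.
Qed.

Lemma momentsP f g : moments f = moments g <->
  forall m : I, inner f (Phi_comp m) = inner g (Phi_comp m).
Proof.
split=> [E m|E]; last by apply/colP => m; rewrite !mxE.
by have := congr1 (fun A : 'cV[R]_(1 + (d + 1)) => A m 0) E; rewrite !mxE.
Qed.

(** When [psi] is dual to [Phi], a function with the moments of [g], depending on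
    [g] through its moments alone. *)
Definition moment_lift (psi : I -> 'rV[R]_d -> R) g (v : 'rV[R]_d) : R :=
  \sum_m inner g (Phi_comp m) * psi m v.

Section with_dual.
Variables (N : nat) (psi : I -> 'rV[R]_d -> R).
Hypothesis psi_trig : forall m, trig_poly N (psi m).
Hypothesis psi_dual : forall m n, inner (psi m) (Phi_comp n) = (m == n)%:R.

Let s_psi m : square_integrable (psi m) := trig_poly_square_integrable (psi_trig m).

Lemma trig_poly_moment_lift g : trig_poly N (moment_lift psi g).
Proof. by apply: trig_poly_sum => m _. Qed.

Lemma inner_moment_lift g n : inner (moment_lift psi g) (Phi_comp n) = inner g (Phi_comp n).
Proof.
rewrite inner_suml //; last exact: square_integrable_Phi.
rewrite (bigD1 n) //= psi_dual eqxx mulr1 big1 ?addr0 // => m /negPf mn.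
by rewrite psi_dual mn mulr0.
Qed.

Lemma admissible_correction g f : trig_poly N g -> square_integrable f ->
  admissible N f (fun v => g v + moment_lift psi (fun v => f v - g v) v).
Proof.
move=> tg sf; have sg := trig_poly_square_integrable tg.
have tl := trig_poly_moment_lift (fun v => f v - g v).
split; first exact: trig_polyD.
apply/momentsP => m; have sP := @square_integrable_Phi R d m.
rewrite (innerDl sg (trig_poly_square_integrable tl) sP).
by rewrite inner_moment_lift (innerBl sf sg sP) addrC subrK.
Qed.

(** The space [W] of trigonometric polynomials without moments is spanned by the
    waves with their moments removed, and admissible functions differ by
    elements of [W]; so the minimizer is an admissible [h0] plus the projection
    of [f - h0] onto [W]. *)
Lemma conservative_projection_exists f : square_integrable f ->
  conservative_projection N f !=set0.
Proof.
move=> sf.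
pose J : finType := (bool * {ffun 'I_d -> 'I_N.*2.+1})%type.
pose u (x : J) : 'rV[R]_d -> R := basis_wave (d := d) (N := N) x.
have tu x : trig_poly N (u x) by apply: trig_poly_wave => i; exact: freq_bound.
have su x := trig_poly_square_integrable (tu x).
pose F x v := u x v - moment_lift psi (u x) v.
have tF x : trig_poly N (F x).
  have := trig_polyD (tu x) (trig_polyZ (-1) (trig_poly_moment_lift (u x))).
  by congr trig_poly; apply/funext => v; rewrite mulN1r.
have sF x := trig_poly_square_integrable (tF x).
have PF x m : inner (F x) (Phi_comp m) = 0.
  rewrite innerBl ?inner_moment_lift ?subrr //; last exact: square_integrable_Phi.
  exact: trig_poly_square_integrable (trig_poly_moment_lift _).
pose W g := trig_poly N g /\ forall m : I, inner g (Phi_comp m) = 0.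
have spanW : span F (index_enum J) `<=` W.
  apply: span_ind; first by split; [exact: trig_poly0|move=> m; exact: inner0l].
  move=> t x h [th hm]; split; first by apply: trig_polyD => //; exact: trig_polyZ.
  move=> m; have sP := @square_integrable_Phi R d m.
  have sh := trig_poly_square_integrable th.
  rewrite (innerDl (square_integrableZ t (sF x)) sh sP) (innerZl t (sF x) sP).
  by rewrite PF hm mulr0 addr0.
have Wspan g : W g -> span F (index_enum J) g.
  move=> [/trig_polyE[c gE] gm]; have := span_sum F (index_enum J) c.
  congr span; apply/funext => v.
  under eq_bigr do rewrite mulrBr.
  rewrite sumrB [X in _ - X](_ : _ = moment_lift psi g v).
    by rewrite /moment_lift [X in _ - X]big1 ?subr0 ?gE // => m _; rewrite -gE gm mul0r.
  rewrite /moment_lift; under eq_bigr do rewrite mulr_sumr.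
  rewrite exchange_big; apply: eq_bigr => m _ /=.
  rewrite gE inner_suml // ?mulr_suml; last exact: square_integrable_Phi.
  by apply: eq_bigr => x _; rewrite mulrA.
pose h0 := moment_lift psi f.
have th0 : trig_poly N h0 := trig_poly_moment_lift f.
have sh0 := trig_poly_square_integrable th0.
have [w sw fw] := span_projection sF (index_enum J) (square_integrableB sf sh0).
have [tw wm] := spanW _ sw; have sw' := trig_poly_square_integrable tw.
pose g v := h0 v + w v.
have tg : trig_poly N g by exact: trig_polyD.
have sg := trig_poly_square_integrable tg.
have gm m : inner g (Phi_comp m) = inner f (Phi_comp m).
  have sP := @square_integrable_Phi R d m.
  by rewrite innerDl // inner_moment_lift wm addr0.
exists g; split; first by split => //; apply/momentsP.
move=> h [th /momentsP hm]; have sh := trig_poly_square_integrable th.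
rewrite !sqr_L2norm.
have shg := square_integrableB sh sg; have sgf := square_integrableB sg sf.
have -> : (h \- f) = (fun v => (h v - g v) + (g v - f v)) by apply/funext => v /=; ring.
rewrite (inner_addadd shg sgf).
suff -> : inner (fun v => h v - g v) (fun v => g v - f v) = 0.
  by rewrite mulr0 addr0 lerDr inner_ge0.
have Whg : W (fun v => h v - g v).
  split.
    have := trig_polyD th (trig_polyZ (-1) tg).
    by congr trig_poly; apply/funext => v; rewrite mulN1r.
  move=> m; rewrite innerBl ?hm ?gm ?subrr //; exact: square_integrable_Phi.
have := fw _ (Wspan _ Whg); rewrite innerC => H.
have -> : (fun v => g v - f v) = (fun v => (-1) * (f v - h0 v - w v)).
  by apply/funext => v; rewrite /g; ring.
rewrite innerZr ?H ?mulr0 //.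
by apply: square_integrableB => //; exact: square_integrableB.
Qed.

Definition correction_cst : R := 1 + \sum_m L2norm (@Phi_comp R d m) * L2norm (psi m).

Lemma correction_cst_ge0 : 0 <= correction_cst.
Proof.
by rewrite addr_ge0 // sumr_ge0 // => m _; rewrite mulr_ge0 // L2norm_ge0.
Qed.

(** Comparison with the admissible correction of [g]: the coefficients of the
    correction are the moments of [f - g], which Cauchy-Schwarz bounds. *)
Lemma quasi_optimal f fNc g : square_integrable f -> conservative_projection N f fNc ->
  trig_poly N g ->
  L2norm (f \- fNc) <= correction_cst * L2norm (fun v => f v - g v).
Proof.
move=> sf [_ minf] tg; have sg := trig_poly_square_integrable tg.
have sfg := square_integrableB sf sg.
have := minf _ (admissible_correction tg sf).
rewrite ler_sqr ?nnegrE ?L2norm_ge0 //.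
rewrite [L2norm (fNc \- f)]L2norm_subC; move=> /le_trans; apply.
set e := (fun v => f v - g v).
rewrite (_ : _ \- f = (fun v => (g v - f v) + moment_lift psi e v)); last first.
  by apply/funext => v /=; rewrite addrAC.
have sl := trig_poly_square_integrable (trig_poly_moment_lift e).
apply: le_trans (L2norm_triangle (square_integrableB sg sf) sl) _.
rewrite L2norm_subC -/e mulrDl mul1r lerD2l.
apply: le_trans (L2norm_sum_le _ _ s_psi) _.
rewrite mulr_suml; apply: ler_sum => m _.
rewrite mulrAC ler_wpM2r ?L2norm_ge0 // mulrC.
exact: CauchySchwarz sfg (@square_integrable_Phi R d m).
Qed.

End with_dual.

Lemma weak_partialP (a : 'I_d -> nat) r f : Hp r f -> (multi_order a <= r)%N ->
  L2p (weak_partial a f) /\ weak_derivative a f (weak_partial a f).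
Proof.
move=> [_ H] /H [g Lg wg].
exact: (@xgetPex _ (fun=> 0) [set g | L2p g /\ weak_derivative a f g])
  (ex_intro _ g (conj Lg wg)).
Qed.

Lemma weak_partial_le_Hnorm r (a : {ffun 'I_d -> 'I_r.+1}) f :
  (multi_order (fun i => a i) <= r)%N ->
  inner (weak_partial (fun i => a i) f) (weak_partial (fun i => a i) f) <= Hnorm r f ^+ 2.
Proof.
move=> ar; rewrite sqr_sqrtr; last by apply: sumr_ge0 => b _; rewrite sqr_ge0.
rewrite (bigD1 a) //= sqr_L2norm lerDl.
by apply: sumr_ge0 => b _; rewrite sqr_ge0.
Qed.

(** The [d] pure derivatives of order [r] are among those that the Sobolev norm
    collects; bounding each by the full norm gives the factor [sqrt d]. *)
Lemma fourier_rate_Hnorm N r f : (1 <= N)%N -> Hp r f ->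
  L2norm (fun v => f v - fourier_sum (freqs d N) f v) <=
    Num.sqrt d%:R / N%:R ^+ r * Hnorm r f.
Proof.
move=> N1 Hf; have [Lf _] := Hf; have sf := L2p_square_integrable Lf.
pose a j : {ffun 'I_d -> 'I_r.+1} := [ffun i => if i == j then ord_max else ord0].
have aE j : (fun i => a j i : nat) = single_order j r.
  by apply/funext => i; rewrite ffunE /single_order; case: (i == j).
have ao j : (multi_order (fun i => a j i) <= r)%N by rewrite aE multi_order_single.
pose g j := weak_partial (fun i => a j i) f.
have Hg j := weak_partialP Hf (ao j).
have sg j : square_integrable (g j) by apply: L2p_square_integrable; case: (Hg j).
have wg j : weak_derivative (single_order j r) f (g j) by rewrite -aE; case: (Hg j).
have N0 : 0 <= N%:R ^- r :> R by rewrite invr_ge0 exprn_ge0.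
rewrite -ler_sqr ?nnegrE ?L2norm_ge0 ?mulr_ge0 ?sqrtr_ge0 //.
rewrite sqr_L2norm fourier_error ?freqs_uniq // => [|k]; last by rewrite freqs_opp.
apply: le_trans (fourier_rate N1 sf sg wg) _.
rewrite !exprMn sqr_sqrtr // mulrAC mulrC ler_wpM2r ?sqr_ge0 //.
apply: le_trans (ler_sum _ (fun j _ => weak_partial_le_Hnorm f (ao j))) _.
by rewrite sumr_const card_ord mulr_natl.
Qed.

End final.

Theorem theorem3p4 (R : realType) (d r : nat) (hd : (1 <= d)%N) :
  exists C : R -> R -> R,
    forall f : 'rV[R]_d -> R, Hp r f ->
    forall N : nat, (1 <= N)%N ->
      conservative_projection N f !=set0 /\
      forall fNc : 'rV[R]_d -> R, conservative_projection N f fNc ->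
        L2norm (f \- fNc) <=
          C (spectral_radius (Phi_gram R d)) (Phi_norm2 R d) / N%:R ^+ r
          * Hnorm r f.
Proof.
have [psi [psi_trig psi_dual]] := dual_functions R hd.
exists (fun _ _ => correction_cst psi * Num.sqrt d%:R) => f Hf N N1.
have [Lf _] := Hf; have sf := L2p_square_integrable Lf.
split; first exact: (conservative_projection_exists (fun m => psi_trig N m N1) psi_dual sf).
move=> fNc Pf.
apply: le_trans (quasi_optimal (fun m => psi_trig N m N1) psi_dual sf Pf
  (trig_poly_fourier_sum N f)) _.
rewrite -!mulrA ler_wpM2l ?correction_cst_ge0 // mulrA.
exact: fourier_rate_Hnorm.
Qed.
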